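(* Let $p>1$, $0<s<1$, $1<q\le p$, and let $\Omega\subset\mathbb{R}^n$ be a bounded open set which has regular boundary for the $s$-fractional $p$-Laplacian. Let $$\Lambda_{p,q}:=\inf_{\phi\in C_0^\infty(\Omega)}\Big\{\iint_{\mathbb{R}^n\times\mathbb{R}^n}\frac{|\phi(x)-\phi(y)|^p}{|x-y|^{n+ps}}\,dx\,dy:\ \|\phi\|_{L^q(\Omega)}=1\Big\}.$$ Then there exist no sequences $\lambda_i>\Lambda_{p,q}$ and $u_i\in V^{s,p}_0(\Omega|\mathbb{R}^n)$ satisfying $$\|u_i\|_{L^q(\Omega)}=1,\qquad\lim_{i\to\infty}\lambda_i=\Lambda_{p,q},\qquad(-\Delta_p)^su_i=\lambda_i|u_i|^{q-2}u_i\ \text{ weakly in }\Omega.$$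
   Context: $V^{s,p}(\Omega|\mathbb{R}^n)$ is the set of $u:\mathbb{R}^n\to\mathbb{R}$ with $u|_\Omega\in L^p(\Omega)$ and $\frac{u(x)-u(y)}{|x-y|^{n/p+s}}\in L^p(\Omega\times\mathbb{R}^n)$. $V^{s,p}_0(\Omega|\mathbb{R}^n)$ is the completion of $C_0^\infty(\Omega)$ in $V^{s,p}(\Omega|\mathbb{R}^n)$ with respect to $[u]_{V^{s,p}(\mathbb{R}^n)}=\big(\iint_{\mathbb{R}^n\times\mathbb{R}^n}\frac{|u(x)-u(y)|^p}{|x-y|^{n+ps}}dxdy\big)^{1/p}$. For $g\in V^{s,p}(\Omega|\mathbb{R}^n)$, $V^{s,p}_g(\Omega|\mathbb{R}^n)=\{u\in V^{s,p}(\Omega|\mathbb{R}^n):u-g\in V^{s,p}_0(\Omega|\mathbb{R}^n)\}$. A function $u\in V^{s,p}_g(\Omega|\mathbb{R}^n)$ is a weak solution of $(-\Delta_p)^su=f$ in $\Omega$ (with $f$ in the dual of $V^{s,p}_0(\Omega|\mathbb{R}^n)$) if $$\iint_{\mathbb{R}^n\times\mathbb{R}^n}\frac{|u(x)-u(y)|^{p-2}(u(x)-u(y))(\phi(x)-\phi(y))}{|x-y|^{n+ps}}dxdy=\int_\Omega f\phi\,dx\quad\text{for all }\phi\in C_0^\infty(\Omega).$$ A point $\xi_0\in\partial\Omega$ is regular for the $s$-fractional $p$-Laplacian if for all $f\in L^\infty(\Omega)$, $g\in C(\mathbb{R}^n)\cap V^{s,p}(\Omega|\mathbb{R}^n)$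 and every weak solution $u\in V^{s,p}_g(\Omega|\mathbb{R}^n)$ of $(-\Delta_p)^su=f$ in $\Omega$, one has $\lim_{\xi\to\xi_0}u(\xi)=g(\xi_0)$. $\Omega$ has (Wiener) regular boundary for the $s$-fractional $p$-Laplacian if every point of $\partial\Omega$ is regular. *)

(* Defs.v *)
From HB Require Import structures.
From mathcomp Require Import all_boot all_order all_algebra.
From mathcomp Require Import all_classical all_reals all_analysis.

Set Implicit Arguments.
Unset Strict Implicit.
Unset Printing Implicit Defensive.

Import Order.TTheory GRing.Theory Num.Theory.
Import numFieldNormedType.Exports.

Local Open Scope classical_set_scope.
Local Open Scope ring_scope.

(* R^n is 'rV[R]_n, with the library's (sup-norm) topology.  Its sigma-algebra
   is generated by the coordinates, as for the library's tuples; this is the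
   Borel sigma-algebra (see rV_open_measurable). *)

Definition rV_display : measure_display. Proof. exact. Qed.

Section rV_measurable.
Context (R : realType) (n : nat).

Definition rV_coord (i : 'I_n) (v : 'rV[R]_n) : R := v ord0 i.

Let rV_set0 : g_sigma_preimage rV_coord set0.
Proof. exact: sigma_algebra0. Qed.

Let rV_setC A : g_sigma_preimage rV_coord A -> g_sigma_preimage rV_coord (~` A).
Proof. exact: sigma_algebraC. Qed.

Let rV_bigcup (F : (set 'rV[R]_n)^nat) :
  (forall i, g_sigma_preimage rV_coord (F i)) ->
  g_sigma_preimage rV_coord (\bigcup_i (F i)).
Proof. exact: sigma_algebra_bigcup. Qed.

HB.instance Definition _ := @isMeasurable.Build rV_display 'rV[R]_n
  (g_sigma_preimage rV_coord) rV_set0 rV_setC rV_bigcup.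

End rV_measurable.

Lemma measurable_rV_coord (R : realType) n (i : 'I_n) :
  measurable_fun [set: 'rV[R]_n] (rV_coord i).
Proof.
move=> _ Y mY; rewrite setTI; apply: sub_sigma_algebra => /=.
rewrite -bigcup_seq/=; exists i => /=; first by rewrite mem_index_enum.
by exists Y => //; rewrite setTI.
Qed.

Lemma measurable_fun_rV d (T : measurableType d) (R : realType) n
    (f : T -> 'rV[R]_n) :
  (forall i, measurable_fun [set: T] (fun t => f t ord0 i)) ->
  measurable_fun [set: T] f.
Proof.
move=> mf.
have : g_sigma_preimage (fun i => rV_coord i \o f) `<=` measurable.
  apply: smallest_sub; first exact: sigma_algebra_measurable.
  case: n => [|n] in f mf *; first by rewrite big_ord0.
  rewrite -bigcup_mkord_ord; apply: bigcup_sub => i Ii.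
  by move=> A [B mB <-]; exact: mf.
by rewrite g_sigma_preimage_comp => H _ A mA; apply: H; exists A.
Qed.

Lemma rV_open_measurable (R : realType) n (A : set 'rV[R]_n) :
  open A -> measurable A.
Proof.
move=> oA.
pose B (q : 'rV[rat]_n * rat) :=
  \bigcap_(i in [set: 'I_n]) [set v : 'rV[R]_n | `|v ord0 i - ratr (q.1 ord0 i)| < ratr q.2].
have -> : A = \bigcup_(q in [set q | B q `<=` A]) B q.
  apply/seteqP; split => [x Ax|x [q qA Bqx]]; last exact: qA.
  have /nbhs_ballP[e /= e0 eA] : nbhs x A by exact: open_nbhs_nbhs.
  have [r] := rat_in_itvoo (divr_gt0 e0 (@ltr0n R 2)).
  rewrite in_itv/= => /andP[r0 re].
  have /choice[q qP] : forall i, exists q : rat, `|x ord0 i - ratr q| < ratr r.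
    move=> i; have [q] := @rat_in_itvoo R (x ord0 i - ratr r) (x ord0 i + ratr r)
      ltac:(by rewrite ltrBlDr -addrA ltrDl addr_gt0).
    by rewrite in_itv/= => qi; exists q; rewrite distrC ltr_distl.
  exists (\row_i q i, r); last first.
    by move=> i _ /=; rewrite mxE.
  move=> y /= By; apply: eA; split => // i j.
  rewrite ord1 /ball/=.
  have /= := By j I; rewrite mxE => yj.
  rewrite (le_lt_trans (ler_distD (ratr (q j)) _ _))// (splitr e).
  by rewrite ltrD//; [rewrite (lt_trans (qP j))|rewrite distrC (lt_trans yj)].
rewrite bigcup_mkcond; apply: countable_bigcupT_measurable => // q.
case: ifP => // _; apply: fin_bigcap_measurable => // i _.
rewrite [X in measurable X](_ : _ =
    [set: 'rV[R]_n] `&` rV_coord i @^-1` `](ratr (q.1 ord0 i) - ratr q.2 : R), (ratr (q.1 ord0 i) + ratr q.2)[).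
  apply: measurable_rV_coord => //; exact: measurable_itv.
by rewrite setTI; apply/seteqP; split => v /=; rewrite in_itv/= ltr_distl.
Qed.

(* The library's canonical sigma-finite structure on m1 \x m2 is only found for
   subprobability factors. *)
Lemma product_measure1_sigma_finite d1 d2 (T1 : measurableType d1)
    (T2 : measurableType d2) (R : realType)
    (m1 : {sigma_finite_measure set T1 -> \bar R})
    (m2 : {sigma_finite_measure set T2 -> \bar R}) :
  sigma_finite setT (m1 \x m2)%E.
Proof.
have /sigma_finiteP[F [TF ndF Foo]] := sigma_finiteT m1.
have /sigma_finiteP[G [TG ndG Goo]] := sigma_finiteT m2.
exists (fun n => F n `*` G n).
 rewrite -setXTT TF TG predeqE => -[x y]; split.
    move=> [/= [n _ Fnx] [k _ Gky]]; exists (maxn n k) => //; split.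
    - by move: x Fnx; exact/subsetPset/ndF/leq_maxl.
    - by move: y Gky; exact/subsetPset/ndG/leq_maxr.
  by move=> [n _ []/= ? ?]; split; exists n.
move=> k; have [? ?] := Foo k; have [? ?] := Goo k.
split; first exact: measurableX.
by rewrite product_measure1E// lte_mul_pinfty// ge0_fin_numE.
Qed.

Section rV_lebesgue.
Context (R : realType).

Definition rV_cons n (z : R * 'rV[R]_n) : 'rV[R]_n.+1 :=
  \row_i (if unlift ord0 i is Some j then z.2 ord0 j else z.1).

Definition rV_uncons n (v : 'rV[R]_n.+1) : R * 'rV[R]_n :=
  (v ord0 ord0, \row_j v ord0 (lift ord0 j)).

Lemma rV_uncons_consK n : cancel (@rV_uncons n) (@rV_cons n).
Proof.
move=> v; apply/rowP => i; rewrite mxE.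
by case: unliftP => [j|] -> //=; rewrite mxE.
Qed.

Lemma rV_consK n : cancel (@rV_cons n) (@rV_uncons n).
Proof.
move=> [x v]; rewrite /rV_uncons mxE unlift_none; congr (_, _).
by apply/rowP => j; rewrite !mxE liftK.
Qed.

Lemma measurable_rV_cons n : measurable_fun [set: R * 'rV[R]_n] (@rV_cons n).
Proof.
apply: measurable_fun_rV => i.
under eq_fun do rewrite mxE.
case: unliftP => [j|] _; last exact: measurable_fst.
exact: (measurableT_comp (@measurable_rV_coord R n j) measurable_snd).
Qed.

Lemma measurable_rV_uncons n : measurable_fun [set: 'rV[R]_n.+1] (@rV_uncons n).
Proof.
apply/measurable_fun_pairP; split; first exact: measurable_rV_coord.
apply: measurable_fun_rV => j /=.
under eq_fun do rewrite mxE.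
exact: measurable_rV_coord.
Qed.

Section step.
Context n (m : {sigma_finite_measure set 'rV[R]_n -> \bar R}).

Definition rV_lebesgue_step : set 'rV[R]_n.+1 -> \bar R :=
  pushforward (@lebesgue_measure R \x m)%E (@rV_cons n).

Let step0 : rV_lebesgue_step set0 = 0%E.
Proof. by rewrite /rV_lebesgue_step /pushforward preimage_set0 measure0. Qed.

Let step_ge0 A : (0 <= rV_lebesgue_step A)%E.
Proof. by rewrite /rV_lebesgue_step /pushforward measure_ge0. Qed.

Let step_sigma_additive : semi_sigma_additive rV_lebesgue_step.
Proof.
move=> F mF tF mUF; rewrite /rV_lebesgue_step /pushforward preimage_bigcup.
apply: measure_semi_sigma_additive.
- by move=> k; rewrite -[X in measurable X]setTI; exact: measurable_rV_cons.
- apply/trivIsetP => /= i j _ _ ij; rewrite -preimage_setI.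
  by move/trivIsetP : tF => /(_ _ _ _ _ ij) ->//; rewrite preimage_set0.
- by rewrite -preimage_bigcup -[X in measurable X]setTI; exact: measurable_rV_cons.
Qed.

HB.instance Definition _ :=
  isMeasure.Build _ _ _ rV_lebesgue_step step0 step_ge0 step_sigma_additive.

Let step_sigma_finite : sigma_finite setT rV_lebesgue_step.
Proof.
have [F FT Ff] :=
  product_measure1_sigma_finite (@lebesgue_measure R) m.
exists (fun k => @rV_uncons n @^-1` F k).
  by rewrite -preimage_bigcup -FT preimage_setT.
move=> k; have [mF Fk] := Ff k; split.
  by rewrite -[X in measurable X]setTI; exact: measurable_rV_uncons.
rewrite /rV_lebesgue_step /pushforward -comp_preimage.
by rewrite (_ : _ \o _ = id) ?preimage_id//; apply/funext => z; exact: rV_consK.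
Qed.

HB.instance Definition _ :=
  Measure_isSigmaFinite.Build _ _ _ rV_lebesgue_step step_sigma_finite.

End step.

Fixpoint rV_lebesgue n : {sigma_finite_measure set 'rV[R]_n -> \bar R} :=
  match n with
  | 0 => \d_(0 : 'rV[R]_0)
  | n'.+1 => rV_lebesgue_step (rV_lebesgue n')
  end.

Lemma measurable_rV_box n (A : 'I_n -> set R) : (forall i, measurable (A i)) ->
  measurable [set v : 'rV[R]_n | forall i, A i (v ord0 i)].
Proof.
move=> mA.
have -> : [set v : 'rV[R]_n | forall i, A i (v ord0 i)] =
    \bigcap_(i in [set: 'I_n]) (rV_coord i @^-1` A i).
  by apply/seteqP; split => [v Av i _|v Av i]; exact: Av.
apply: fin_bigcap_measurable => // i _.
by rewrite -[X in measurable X]setTI; exact: measurable_rV_coord.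
Qed.

Lemma rV_lebesgue_box n (A : 'I_n -> set R) : (forall i, measurable (A i)) ->
  rV_lebesgue n [set v | forall i, A i (v ord0 i)] =
  (\prod_(i < n) @lebesgue_measure R (A i))%E.
Proof.
elim: n A => [|n IH] A mA.
  by rewrite big_ord0 /= diracE mem_set// => -[].
rewrite big_ord_recl -IH// /= /rV_lebesgue_step /pushforward.
rewrite -product_measure1E; last 2 first.
- exact: mA.
- exact: (@measurable_rV_box n (fun j => A (lift ord0 j))).
congr ((_ \x _)%E _); apply/seteqP; split => [[x v] /= H|[x v] /= [Hx Hv] i].
  split => [|j]; first by have := H ord0; rewrite mxE unlift_none.
  by have := H (lift ord0 j); rewrite mxE liftK.
by rewrite mxE; case: unliftP => [j|] ->.
Qed.

End rV_lebesgue.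

Section function_spaces.
Context (R : realType) (n : nat).
Implicit Types (u g f phi : 'rV[R]_n -> R) (Omega : set 'rV[R]_n) (s p q : R).

Local Notation mu := (rV_lebesgue R n).

(* The library's norm on 'rV[R]_n is the sup norm, hence this Euclidean one. *)
Definition eucl_norm (x : 'rV[R]_n) : R :=
  Num.sqrt (\sum_(i < n) x ord0 i ^+ 2).

Definition in_Lp d (T : measurableType d) (m : {measure set T -> \bar R})
    (p : \bar R) (D : set T) (f : T -> R) : Prop :=
  measurable_fun D f /\ finite_norm m p (f \_ D).

Definition Lp_norm Omega q u : \bar R := 'N[mu]_q%:E[EFin \o (u \_ Omega)].

Fixpoint of_class_C (k : nat) u : Prop :=
  continuous u /\
  if k is k'.+1 then
    forall i : 'I_n,
      (forall x, derivable (u : 'rV[R]_n -> R^o) x (delta_mx 0 i)) /\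
      of_class_C k' ('D_(delta_mx 0 i) (u : 'rV[R]_n -> R^o))
  else True.

Definition support u : set 'rV[R]_n := closure [set x | u x != 0].

(* C_0^infty(Omega), its elements being extended by 0 to R^n *)
Definition test_function Omega phi : Prop :=
  [/\ forall k, of_class_C k phi, compact (support phi) &
      support phi `<=` Omega].

Definition difference_quotient s p u (z : 'rV[R]_n * 'rV[R]_n) : R :=
  (u z.1 - u z.2) / eucl_norm (z.1 - z.2) `^ (n%:R / p + s).

Definition V_space s p Omega : set ('rV[R]_n -> R) :=
  [set u | in_Lp mu p%:E Omega u /\
    in_Lp (mu \x mu)%E p%:E (Omega `*` setT) (difference_quotient s p u)].

Definition energy s p u : \bar R :=
  (\int[mu \x mu]_z
    (`|u z.1 - u z.2| `^ p / eucl_norm (z.1 - z.2) `^ (n%:R + p * s))%:E)%E.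

Definition V_seminorm s p u : \bar R := (energy s p u `^ p^-1)%E.

(* The seminorm does not see constants, although it is a norm on test functions;
   the completion is realised inside V_space by requiring convergence in L^p as
   well.  For bounded Omega a sequence of test functions that is Cauchy for the
   seminorm is Cauchy in L^p (fractional Poincare inequality), so that this
   selects exactly one function (up to null sets) for each such sequence. *)
Definition V0_space s p Omega : set ('rV[R]_n -> R) :=
  [set u | V_space s p Omega u /\
    exists phi : nat -> 'rV[R]_n -> R,
      [/\ forall k, test_function Omega (phi k),
          V_seminorm s p (u \- phi k) @[k --> \oo] --> 0%E &
          'N[mu]_p%:E[EFin \o (u \- phi k)%R]%E @[k --> \oo] --> 0%E]].

Definition Vg_space s p Omega g : set ('rV[R]_n -> R) :=
  [set u | V_space s p Omega u /\ V0_space s p Omega (u \- g)].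

Definition weak_solution s p Omega f u : Prop :=
  forall phi, test_function Omega phi ->
    (\int[mu \x mu]_z
       (`|u z.1 - u z.2| `^ (p - 2) * (u z.1 - u z.2) * (phi z.1 - phi z.2) /
          eucl_norm (z.1 - z.2) `^ (n%:R + p * s))%:E =
     \int[mu]_(x in Omega) (f x * phi x)%:E)%E.

(* Elements of V_space are defined up to null sets only, so that their limit at
   a point is taken along this filter: A is in ess_nbhs x when some neighbourhood
   of x is contained in A up to a null set. *)
Definition ess_nbhs (x : 'rV[R]_n) : set_system 'rV[R]_n :=
  [set A | exists2 U, nbhs x U & mu.-negligible (U `\` A)].

Global Instance ess_nbhs_filter x : Filter (ess_nbhs x).
Proof.
split.
- by exists setT; [exact: filterT|rewrite setDv; exact: negligible_set0].
- move=> A B [U xU UA] [V xV VB]; exists (U `&` V); first exact: filterI.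
  apply: (negligibleS _ (negligibleU UA VB)) => y [[Uy Vy] /= nAB].
  by have [Ay|nAy] := pselect (A y); [right; split => // By; exact: nAB|left].
- move=> A B AB [U xU UA]; exists U => //.
  by apply: (negligibleS _ UA) => y [Uy nBy]; split => // /AB.
Qed.

Definition boundary Omega : set 'rV[R]_n := closure Omega `\` interior Omega.

Definition regular_point s p Omega (x0 : 'rV[R]_n) : Prop :=
  forall f g u,
    in_Lp mu +oo%E Omega f ->
    continuous g -> V_space s p Omega g ->
    Vg_space s p Omega g u -> weak_solution s p Omega f u ->
    u x @[x --> ess_nbhs x0] --> g x0.

Definition regular_boundary s p Omega : Prop :=
  forall x0, boundary Omega x0 -> regular_point s p Omega x0.

Definition Lambda s p q Omega : \bar R :=
  ereal_inf [set energy s p phi | phi in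
    [set phi | test_function Omega phi /\ Lp_norm Omega q phi = 1%E]].

End function_spaces.

(* Main.v *)
Require Import Defs.
From mathcomp Require Import all_boot all_order all_algebra.
From mathcomp Require Import all_classical all_reals all_analysis.
From mathcomp Require Import measurable_realfun ring lra.

Set Implicit Arguments.
Unset Strict Implicit.
Unset Printing Implicit Defensive.

Import Order.TTheory GRing.Theory Num.Theory.
Import numFieldNormedType.Exports.

Local Open Scope classical_set_scope.
Local Open Scope ring_scope.

(** The weak formulation of an L^q-normalized solution [u] extends to almost
    everywhere limits of test functions with dominated difference quotients, so
    [u], [|u|] and [phi^q / (u + eps)^(q-1)] are all admissible.

    If [lambda] is close to Lambda, comparing the energies of [u] and [|u|] shows
    that one of the sets [{u < -d}], [{u > d}] is small while the other is not.
    Say the first is small.  Testing with the negative part of [u], the nonlocal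
    cross term is at least [c] times the integral of [u^-], which beats the
    contribution to [lambda] times the integral of [(u^-)^q] of the points where
    [u^-] is small, because q > 1; on the small set where [u^-] is large, the
    singularity of the kernel produces an arbitrarily large multiple of [(u^-)^p].
    Hence [u] has a sign.

    For nonnegative [u], Picone's inequality with the test functions
    [phi^q / (u + eps)^(q-1)] gives [lambda <= energy phi] for every normalized
    [phi], i.e. [lambda <= Lambda].  The argument needs no compact embedding. *)

(** * Power inequalities *)

(** The sign must be settled before [lambda] is compared with Lambda, since Picone's inequality
    divides by powers of [u + eps]. The exclusion of sign changes is quantitative and replaces
    strong convergence to a first eigenfunction. A function that is large only on a tiny set has too
    much energy, because the kernel is not integrable near the diagonal; so an upper bound on
    [lambda] alone yields [d] and [m] such that |u| > d on a set of measure at least [m]. On a pair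
    of points with u < -e at one and u > e at the other, the energy density of [u] exceeds that of
    |u| by at least e^p times the kernel, while |u| is itself a competitor for Lambda; hence the
    product of the measures of the two sets is at most a multiple of lambda - Lambda. The constants
    are fixed in this order: [d] and [m], a level [e], a measure below which the kernel estimate
    applies, and last the distance [eta] from Lambda. In the Picone step the limit in [eps] would
    lose the points where u = 0. That [phi] vanishes at almost all of them is a strong minimum
    principle, extracted from the same identity. *)

Section real_inequalities.
Context (R : realType).
Implicit Types (a b c d t p q r : R).

(** The derivative of |t|^p / p. The factor [t] makes the value at 0 equal to 0 also for p < 2. *)
Definition signed_pow p t : R := `|t| `^ (p - 2) * t.

Lemma ger0_signed_pow p t : 1 < p -> 0 <= t -> signed_pow p t = t `^ (p - 1).
Proof.
move=> p1 t0; rewrite /signed_pow ger0_norm//.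
move: t0; rewrite le_eqVlt => /predU1P[<-|t0].
  by rewrite mulr0 powR0// subr_eq0 gt_eqF.
rewrite -[X in _ * X]powRr1 ?(ltW t0)// -powRD ?(gt_eqF t0) ?implybT//.
by congr (_ `^ _); ring.
Qed.

Lemma signed_powN p t : signed_pow p (- t) = - signed_pow p t.
Proof. by rewrite /signed_pow normrN mulrN. Qed.

Lemma norm_signed_pow p t : 1 < p -> `|signed_pow p t| = `|t| `^ (p - 1).
Proof.
move=> p1; rewrite -(ger0_signed_pow p1 (normr_ge0 t)).
by rewrite /signed_pow normrM normr_id ger0_norm ?powR_ge0.
Qed.

Lemma signed_powM p t : 1 < p -> signed_pow p t * t = `|t| `^ p.
Proof.
move=> p1; rewrite -[RHS]mulr_powRB1//; last by rewrite (lt_trans _ p1).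
rewrite -(ger0_signed_pow p1 (normr_ge0 t)) /signed_pow normr_id.
by rewrite mulrCA -mulrA -!expr2 real_normK// num_real.
Qed.

Lemma signed_pow0 p : signed_pow p 0 = 0.
Proof. by rewrite /signed_pow mulr0. Qed.

Lemma powRV r a : 0 <= a -> a^-1 `^ r = (a `^ r)^-1.
Proof. by move=> a0; rewrite -powR_inv1// powRAC powR_inv1 ?powR_ge0. Qed.

Lemma powR_max p a b : 0 <= p -> 0 <= a -> 0 <= b ->
  Num.max a b `^ p <= a `^ p + b `^ p.
Proof.
by move=> p0 a0 b0; rewrite /Num.max; case: ifP => _;
  rewrite ?lerDl ?lerDr powR_ge0.
Qed.

Lemma ler_powR2 p a b : 0 <= p -> 0 <= a -> a <= b -> a `^ p <= b `^ p.
Proof.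
by move=> p0 a0 ab; apply: ge0_ler_powR => //; rewrite nnegrE// (le_trans a0).
Qed.

Lemma powRD_le p a b : 0 <= p -> 0 <= a -> 0 <= b ->
  (a + b) `^ p <= 2 `^ p * (a `^ p + b `^ p).
Proof.
move=> p0 a0 b0; apply: (@le_trans _ _ ((2 * Num.max a b) `^ p)).
  apply: ler_powR2 => //; first exact: addr_ge0.
  by rewrite mulr_natl mulr2n lerD// le_max lexx ?orbT.
by rewrite powRM ?le_max ?a0// ler_wpM2l ?powR_ge0// powR_max.
Qed.

(** A number in (0, 1] dominates its p-th power; this is applied to a/(a+b) and b/(a+b), whose sum
    is 1. *)
Lemma powRD_ge p a b : 1 <= p -> 0 <= a -> 0 <= b ->
  a `^ p + b `^ p <= (a + b) `^ p.
Proof.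
move=> p1 a0 b0.
have p0 : p != 0 by rewrite gt_eqF// (lt_le_trans _ p1).
have [ab0|] := ltP 0 (a + b); last first.
  move=> ab; have -> : a = 0 by apply/eqP; rewrite eq_le a0 andbT; lra.
  by rewrite powR0// !add0r.
have split_le c : 0 <= c -> c <= a + b ->
    c `^ p <= c / (a + b) * (a + b) `^ p.
  rewrite le_eqVlt => /predU1P[<- _|c0 cab].
    by rewrite powR0// mul0r mul0r.
  rewrite -[X in X `^ p <= _](divfK (lt0r_neq0 ab0) c) powRM ?divr_ge0 ?(ltW c0) ?(ltW ab0)//.
  rewrite ler_wpM2r ?powR_ge0// ge1r_powR//.
  by rewrite divr_gt0//= ler_pdivrMr// mul1r.
have -> : (a + b) `^ p = a / (a + b) * (a + b) `^ p + b / (a + b) * (a + b) `^ p.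
  by rewrite -mulrDl -mulrDl divff ?mul1r// gt_eqF.
by rewrite lerD// split_le// ?lerDl// lerDr.
Qed.

Lemma powR_le1D q p t : 0 <= q -> q <= p -> 0 <= t -> t `^ q <= 1 + t `^ p.
Proof.
move=> q0 qp t0; have [t1|t1] := leP t 1.
  rewrite -[t `^ q]addr0 lerD ?powR_ge0//.
    by have := ler_powR2 q0 t0 t1; rewrite powR1.
by rewrite -[t `^ q]add0r lerD// ler_powR// ltW.
Qed.

(** Both factors are at most powers of the larger of |a| and |b|. This crude form of Young's
    inequality suffices for domination. *)
Lemma signed_pow_young p a b : 1 < p ->
  `|signed_pow p a * b| <= `|a| `^ p + `|b| `^ p.
Proof.
move=> p1; have p0 : 0 < p by rewrite (lt_trans _ p1).
rewrite normrM norm_signed_pow//.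
apply: le_trans (powR_max (ltW p0) (normr_ge0 a) (normr_ge0 b)).
rewrite -[leRHS]mulr_powRB1 ?le_max ?normr_ge0// mulrC ler_pM ?powR_ge0//.
  by rewrite le_max lexx orbT.
by rewrite ler_powR2 ?subr_ge0 ?(ltW p1)// le_max lexx.
Qed.

Lemma powR_mvt r a b : 0 < a -> 0 < b ->
  exists2 c, Num.min a b <= c <= Num.max a b &
    a `^ r - b `^ r = r * c `^ (r - 1) * (a - b).
Proof.
wlog ab : a b / a <= b.
  move=> W a0 b0; have /orP[ab|ba] := le_total a b; first exact: W.
  have [c cab E] := W b a ba b0 a0; exists c; first by rewrite minC maxC.
  by rewrite -opprB E -mulrN opprB.
move=> a0 b0; have [||c] := @MVT_segment R (fun c => c `^ r)
    (fun c => r * c `^ (r - 1)) a b ab.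
- by move=> c; rewrite in_itv/= => /andP[ac _]; apply: is_derive1_powR; exact: lt_trans ac.
- apply: derivable_within_continuous => c; rewrite in_itv/= => /andP[ac _].
  by apply: derivable_powR; rewrite in_itv/= andbT (lt_le_trans a0 ac).
- rewrite in_itv/= => /andP[ac cb] E; exists c.
    by rewrite ge_min le_max ac cb orbT.
  by rewrite -opprB E -mulrN opprB.
Qed.

Lemma powR_lip_ge1 r M a b : 1 <= r -> 0 < a <= M -> 0 < b <= M ->
  `|a `^ r - b `^ r| <= r * M `^ (r - 1) * `|a - b|.
Proof.
move=> r1 /andP[a0 aM] /andP[b0 bM]; have [c /andP[c1 c2] ->] := powR_mvt r a0 b0.
have c0 : 0 < c by rewrite (lt_le_trans _ c1)// lt_min a0 b0.
have r0 : 0 <= r by exact: le_trans r1.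
rewrite !normrM ler_wpM2r// (ger0_norm r0) ler_wpM2l// ger0_norm ?powR_ge0//.
rewrite ler_powR2 ?subr_ge0// ?(ltW c0)// (le_trans c2)//.
by rewrite ge_max aM bM.
Qed.

Lemma powR_lip_neg r e a b : r <= 0 -> 0 < e -> e <= a -> e <= b ->
  `|a `^ r - b `^ r| <= `|r| * e `^ (r - 1) * `|a - b|.
Proof.
move=> r0 e0 ea eb; have a0 := lt_le_trans e0 ea; have b0 := lt_le_trans e0 eb.
have [c /andP[c1 c2] ->] := powR_mvt r a0 b0.
have c0 : 0 < c by rewrite (lt_le_trans _ c1)// lt_min a0 b0.
have ec : e <= c by rewrite (le_trans _ c1)// le_min ea eb.
rewrite !normrM ler_wpM2r// ler_wpM2l// ger0_norm ?powR_ge0//.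
rewrite -[r - 1]opprK powRN [leRHS]powRN lef_pV2 ?posrE ?powR_gt0//.
by rewrite ler_powR2 ?(ltW e0)// oppr_ge0 subr_le0 (le_trans r0).
Qed.

(** For d < c, convexity of the q-th power is applied to c = t (d/t) + (1-t) ((c-d)/(1-t)). For c <=
    d the left side is nonpositive, because t^(q-1) <= 1. *)
Lemma picone_convexity q t c d : 1 < q -> 0 < t < 1 -> 0 <= c -> 0 <= d ->
  (1 - t) `^ (q - 1) * (c `^ q - d `^ q / t `^ (q - 1)) <= `|c - d| `^ q.
Proof.
move=> q1 /andP[t0 t1] c0 d0.
have q0 : 0 < q by exact: lt_trans q1.
have t10 : 0 < 1 - t by rewrite subr_gt0.
have T0 : 0 < t `^ (q - 1) by exact: powR_gt0.
have S0 : 0 < (1 - t) `^ (q - 1) by exact: powR_gt0.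
have [cd|dc] := leP c d.
  apply: (@le_trans _ _ 0); last exact: powR_ge0.
  rewrite pmulr_rle0// subr_le0 ler_pdivlMr//.
  rewrite (@le_trans _ _ (c `^ q))//; last by rewrite ler_powR2// ltW.
  rewrite ler_piMr ?powR_ge0//.
  have := @ler_powR2 (q - 1) t 1; rewrite powR1; apply; rewrite ?subr_ge0 ltW//.
have cd0 : 0 <= c - d by rewrite subr_ge0 ltW.
rewrite ger0_norm//.
have t01 : 0 <= t <= 1 by rewrite !ltW.
have := @convex_powR R q (ltW q1) (@Itv01 R t (ltW t0) (ltW t1)) (d / t) ((c - d) / (1 - t)).
rewrite !inE /= !in_itv/= !andbT => /(_ (divr_ge0 d0 (ltW t0)) (divr_ge0 cd0 (ltW t10))).
rewrite convRE [X in X `^ _ <= _]convRE /= /unstable.onem.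
rewrite (mulrC t (d / t)) (mulrC (1 - t)) !divfK ?gt_eqF// addrC subrK => H.
have key a : 0 <= a -> forall x, 0 < x -> x * (a / x) `^ q = a `^ q / x `^ (q - 1).
  move=> a0 x x0; rewrite powRM ?invr_ge0 ?(ltW x0)//.
  rewrite powRV ?(ltW x0)//.
  rewrite -(@mulr_powRB1 _ x q) ?(ltW x0)// invfM mulrCA; congr (_ * _).
  by rewrite mulrA divff ?mul1r// gt_eqF.
move: H; rewrite !key// -lerBlDl => H.
by rewrite mulrC -ler_pdivlMr.
Qed.

(* Brasco--Franzina's form of Picone's inequality. *)
Lemma picone p q a b c d : 1 < q -> q <= p -> 0 < a -> 0 < b -> 0 <= c -> 0 <= d ->
  signed_pow p (a - b) * (c `^ q / a `^ (q - 1) - d `^ q / b `^ (q - 1)) <=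
  `|a - b| `^ (p - q) * `|c - d| `^ q.
Proof.
move=> q1 qp; have p1 := lt_le_trans q1 qp.
wlog ab : a b c d / b <= a.
  move=> W a0 b0 c0 d0; have [ab|/ltW ba] := leP b a; first exact: W.
  have := W b a d c ba b0 a0 d0 c0.
  by rewrite (distrC b) (distrC d) -(opprB a b) signed_powN mulNr -mulrN opprB.
move=> a0 b0 c0 d0; move: ab; rewrite le_eqVlt => /predU1P[<-|ab].
  by rewrite subrr signed_pow0 mul0r mulr_ge0 ?powR_ge0.
have ab0 : 0 < a - b by rewrite subr_gt0.
rewrite ger0_signed_pow ?(ltW ab0)// (ger0_norm (ltW ab0)).
(* Splitting off (a-b)^(p-q) leaves the case of exponent [q], which by homogeneity depends on [a]
   and [b] only through the ratio t = b/a. *)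
rewrite (_ : p - 1 = (p - q) + (q - 1)); last by ring.
rewrite (@powRD _ _ (p - q)) ?(gt_eqF ab0) ?implybT// -mulrA ler_wpM2l ?powR_ge0//.
have t01 : 0 < b / a < 1 by rewrite divr_gt0//= ltr_pdivrMr// mul1r.
apply: le_trans (picone_convexity q1 t01 c0 d0).
have -> : 1 - b / a = (a - b) / a by rewrite mulrBl divff// gt_eqF.
rewrite !(powRM, powRN) ?invr_ge0 ?(ltW a0) ?(ltW b0) ?(ltW ab0)//.
rewrite powRV ?(ltW a0)//.
rewrite le_eqVlt; apply/orP; left; apply/eqP.
by field; rewrite ?gt_eqF// powR_gt0.
Qed.

(** Young's inequality with the conjugate exponents p/(p-q) and p/q. For q = p the first exponent is
    infinite, but then both sides agree. *)
Lemma powR_young p q a b : 0 < q -> q <= p -> 0 <= a -> 0 <= b ->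
  a `^ (p - q) * b `^ q <= (1 - q / p) * a `^ p + q / p * b `^ p.
Proof.
move=> q0; rewrite le_eqVlt => /predU1P[<- a0 b0|qp a0 b0].
  by rewrite subrr powRr0 divff ?gt_eqF// subrr mul0r add0r.
have p0 : 0 < p by exact: lt_trans qp.
have pq0 : 0 < p - q by rewrite subr_gt0.
have := @conjugate_powR R (a `^ (p - q)) (b `^ q) (p / (p - q)) (p / q)
  (powR_ge0 _ _) (powR_ge0 _ _) (divr_gt0 p0 pq0) (divr_gt0 p0 q0).
rewrite !invf_div -mulrDl subrK divff ?gt_eqF// => /(_ erefl).
rewrite -!powRrM !(mulrC _ (p / _)) !divfK ?gt_eqF//.
by rewrite [_ * a `^ p]mulrC [_ * b `^ p]mulrC mulrBl divff ?gt_eqF.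
Qed.

Lemma powR_above q p e w : q <= p -> 0 < e -> e < w -> w `^ q <= e `^ (q - p) * w `^ p.
Proof.
move=> qp e0 ew; have w0 : 0 < w by exact: lt_trans ew.
rewrite -[X in w `^ X <= _](subrK p) (@powRD _ _ (q - p)) ?(gt_eqF w0) ?implybT//.
rewrite ler_wpM2r ?powR_ge0// -[q - p]opprB !powRN lef_pV2 ?posrE ?powR_gt0//.
by rewrite ler_powR2 ?subr_ge0 ?(ltW e0)// ltW.
Qed.

(** Below [e] the factor w^(q-1) is at most e^(q-1); above [e] the factor w^(q-p) is at most
    e^(q-p). For q > 1 the coefficient of the linear term becomes small with [e], which allows its
    absorption. *)
Lemma splitting_powR q p e w : 1 <= q -> q <= p -> 0 < e -> 0 <= w ->
  w `^ q <= e `^ (q - 1) * w + e `^ (q - p) * (if e < w then w `^ p else 0).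
Proof.
move=> q1 qp e0 w0.
have q0 : 0 < q by exact: lt_le_trans q1.
case: ltP => [ew|we].
  rewrite -[leLHS]add0r lerD ?mulr_ge0 ?powR_ge0//.
  exact: powR_above.
rewrite mulr0 addr0 -(@mulr_powRB1 _ w q)// mulrC ler_wpM2r//.
by rewrite ler_powR2 ?subr_ge0.
Qed.

End real_inequalities.

(** * Smooth functions and test functions *)

Section smooth_functions.
Context (R : realType) (n : nat).
Implicit Types (u v f : 'rV[R]_n -> R) (k : nat).

Lemma of_class_C_continuous k u : of_class_C k u -> continuous u.
Proof. by case: k => [|k] []. Qed.

(** Exhibited derivatives can be carried through sums, products and powers by induction on [k]. *)
Lemma of_class_CSP k u : of_class_C k.+1 u <->
  continuous u /\ forall i : 'I_n, exists2 du, of_class_C k du &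
    forall x, is_derive x (delta_mx 0 i) (u : 'rV[R]_n -> R^o) (du x).
Proof.
split => [[cu Hu]|[cu Hu]].
  split=> // i; have [du dCu] := Hu i.
  by eexists; [exact: dCu|move=> x; exact/derivableP/du].
split=> // i; have [du dC dudu] := Hu i; split; first by move=> x; apply: ex_derive.
suff -> : 'D_(delta_mx 0 i) (u : 'rV[R]_n -> R^o) = du by [].
by apply/funext => x; apply: derive_val.
Qed.

Lemma of_class_CW k u : of_class_C k.+1 u -> of_class_C k u.
Proof.
elim: k u => [|k IH] u; first by move=> /of_class_C_continuous.
move=> /of_class_CSP[cu Hu]; apply/of_class_CSP; split=> // i.
by have [du /IH Cdu dudu] := Hu i; exists du.
Qed.

Lemma of_class_C_cst k (c : R) : of_class_C k ((fun=> c) : 'rV[R]_n -> R).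
Proof.
elim: k c => [|k IH] c; first by split => // x; exact: cst_continuous.
apply/of_class_CSP; split; first by move=> x; exact: cst_continuous.
by move=> i; exists (fun=> 0); [exact: IH|move=> x; exact: is_derive_cst].
Qed.

Lemma of_class_CD k u v : of_class_C k u -> of_class_C k v ->
  of_class_C k (fun x => u x + v x).
Proof.
elim: k u v => [|k IH] u v Cu Cv.
  have cu := of_class_C_continuous Cu; have cv := of_class_C_continuous Cv.
  by split=> // x; exact: cvgD (cu x) (cv x).
have /of_class_CSP[cu Hu] := Cu; have /of_class_CSP[cv Hv] := Cv.
apply/of_class_CSP; split; first by move=> x; exact: cvgD (cu x) (cv x).
move=> i; have [du Cdu Du] := Hu i; have [dv Cdv Dv] := Hv i.
by exists (fun x => du x + dv x); [exact: IH|move=> x; exact: is_deriveD].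
Qed.

Lemma of_class_CM k u v : of_class_C k u -> of_class_C k v ->
  of_class_C k (fun x => u x * v x).
Proof.
elim: k u v => [|k IH] u v Cu Cv.
  have cu := of_class_C_continuous Cu; have cv := of_class_C_continuous Cv.
  by split=> // x; exact: cvgM (cu x) (cv x).
have /of_class_CSP[cu Hu] := Cu; have /of_class_CSP[cv Hv] := Cv.
apply/of_class_CSP; split; first by move=> x; exact: cvgM (cu x) (cv x).
move=> i; have [du Cdu Du] := Hu i; have [dv Cdv Dv] := Hv i.
exists (fun x => u x * dv x + v x * du x); last by move=> x; exact: is_deriveM.
by apply: of_class_CD; apply: IH => //; exact: of_class_CW.
Qed.

Lemma derive_line f x (v : 'rV[R]_n) :
  'D_1 ((fun h : R => f (h *: v + x)) : R -> R^o) 0 = 'D_v (f : _ -> R^o) x.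
Proof.
rewrite /derive; set g1 := fun h => h^-1 *: _; set g2 := fun h => h^-1 *: _.
suff -> : g1 = g2 by [].
by rewrite funeqE /g1 /g2 => h /=; rewrite addr0 scale0r add0r [_%:A]mulr1.
Qed.

Lemma is_derive_powR_comp f r x (v : 'rV[R]_n) df : 0 < f x ->
  is_derive x v (f : _ -> R^o) df ->
  is_derive x v ((fun y => f y `^ r) : _ -> R^o) (r * f x `^ (r - 1) * df).
Proof.
move=> f0 Df; pose g (h : R) := f (h *: v + x).
have Dg : is_derive (0 : R) 1 (g : R -> R^o) df.
  have [H1 H2] := Df; split; first exact: (iffLR (derivable1P (f : _ -> R^o) x v)).
  by rewrite -H2 derive_line.
have g0 : 0 < g 0 by rewrite /g scale0r add0r.
have [H1 H2] : is_derive (0 : R) 1 ((@powR R ^~ r) \o g : R -> R^o)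
    (r * g 0 `^ (r - 1) * df).
  by apply: (@is_derive1_comp R (@powR R ^~ r) g 0 _ df) => //; exact: is_derive1_powR.
split; first exact: (iffRL (derivable1P ((fun y => f y `^ r) : _ -> R^o) x v)).
by rewrite -derive_line; move: H2; rewrite {2}/g scale0r add0r.
Qed.

(** The exponent must vary in the induction, since the derivative contains the power r - 1. *)
Lemma of_class_C_powR k f r : (forall x, 0 < f x) -> of_class_C k f ->
  of_class_C k (fun x => f x `^ r).
Proof.
move=> f0; elim: k r => [|k IH] r Cf.
  split=> // x; apply: (@continuous_comp _ _ _ f (fun t => t `^ r)); first exact: of_class_C_continuous Cf x.
  apply/differentiable_continuous/derivable1_diffP/derivable_powR.
  by rewrite in_itv/= andbT.
have /of_class_CSP[cf Hf] := Cf.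
apply/of_class_CSP; split.
  exact: of_class_C_continuous (IH r (of_class_CW Cf)).
move=> i; have [df Cdf Df] := Hf i.
exists (fun x => r * f x `^ (r - 1) * df x); last by move=> x; exact: is_derive_powR_comp.
apply: of_class_CM => //; apply: of_class_CM; first exact: of_class_C_cst.
exact/IH/of_class_CW.
Qed.

End smooth_functions.

Section test_functions.
Context (R : realType) (n : nat) (Omega : set 'rV[R]_n).
Implicit Types (phi psi f : 'rV[R]_n -> R).

Lemma test_function_eq0 phi x : test_function Omega phi -> ~ Omega x -> phi x = 0.
Proof.
move=> [_ _ sub] nOx; apply/eqP; apply: contra_notT nOx => phix.
by apply/sub/subset_closure.
Qed.

Lemma test_functions_cvg_eq0 (psi : nat -> 'rV[R]_n -> R) x l :
  (forall k, test_function Omega (psi k)) -> ~ Omega x ->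
  psi k x @[k --> \oo] --> l -> l = 0.
Proof.
move=> tpsi nOx; rewrite (_ : (fun k => psi k x) = fun=> 0).
  by move=> h; apply: cvg_unique h _ => //; exact: cvg_cst.
by apply/funext => k; exact: test_function_eq0 (tpsi k) nOx.
Qed.

Lemma test_function_continuous phi : test_function Omega phi -> continuous phi.
Proof. by move=> [/(_ 0%N)/of_class_C_continuous]. Qed.

(** Vanishing wherever [phi] vanishes keeps the support inside that of [phi]; smooth compositions
    that fix 0 therefore preserve test functions. *)
Lemma test_function_smooth phi psi : test_function Omega phi ->
  (forall k, of_class_C k psi) -> (forall x, phi x = 0 -> psi x = 0) ->
  test_function Omega psi.
Proof.
move=> [Cphi cphi sphi] Cpsi psi0.
have sub : Defs.support psi `<=` Defs.support phi.
  by apply: closureS => x /=; apply: contra_neq => /psi0.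
split => //; last exact: subset_trans sphi.
by apply: subclosed_compact cphi sub; exact: closed_closure.
Qed.

Lemma test_functionZ (c : R) phi : test_function Omega phi ->
  test_function Omega (fun x => c * phi x).
Proof.
move=> tphi; have [Cphi _ _] := tphi.
apply: (test_function_smooth tphi) => [k|x ->]; last by rewrite mulr0.
by apply: of_class_CM => //; exact: of_class_C_cst.
Qed.

Lemma test_function_bounded phi : test_function Omega phi ->
  exists M, forall x, `|phi x| <= M.
Proof.
move=> tphi; have [_ cphi _] := tphi.
have cont := test_function_continuous tphi.
have : compact (phi @` Defs.support phi).
  by apply: continuous_compact => //; exact: continuous_subspaceT.
move=> /compact_bounded[M [Mreal HM]]; exists (`|M| + 1) => x.
have [->|phix] := eqVneq (phi x) 0; first by rewrite normr0 addr_ge0.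
apply: (HM (`|M| + 1)) => /=; first by rewrite ltr_pwDr// ler_norm.
by exists x => //; exact: subset_closure.
Qed.

End test_functions.

(* Smooth and 1-Lipschitz; it tends to the absolute value as [e] tends to 0. *)
Definition soft_abs (R : realType) (e t : R) : R := (t ^+ 2 + e ^+ 2) `^ 2^-1.

Section soft_abs.
Context (R : realType).
Implicit Types (e s t : R).

Lemma sqr_soft_abs e t : soft_abs e t ^+ 2 = t ^+ 2 + e ^+ 2.
Proof.
have h : 0 <= t ^+ 2 + e ^+ 2 by rewrite addr_ge0// sqr_ge0.
by rewrite /soft_abs powR12_sqrt// sqr_sqrtr.
Qed.

Lemma soft_abs_ge0 e t : 0 <= soft_abs e t.
Proof. exact: powR_ge0. Qed.

Lemma soft_abs_gt0 e t : 0 < e -> 0 < soft_abs e t.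
Proof. by move=> e0; rewrite powR_gt0// ltr_wpDl ?sqr_ge0// exprn_gt0. Qed.

Lemma soft_abs_ge e t : 0 <= e -> e <= soft_abs e t.
Proof.
move=> e0; rewrite -(@ler_pXn2r _ 2)// ?nnegrE ?soft_abs_ge0//.
by rewrite sqr_soft_abs lerDr sqr_ge0.
Qed.

Lemma soft_abs_ge_norm e t : `|t| <= soft_abs e t.
Proof.
rewrite -(@ler_pXn2r _ 2)// ?nnegrE ?soft_abs_ge0//.
by rewrite sqr_soft_abs real_normK ?num_real// lerDl sqr_ge0.
Qed.

Lemma soft_abs_le e t : 0 <= e -> soft_abs e t <= `|t| + e.
Proof.
move=> e0; rewrite -(@ler_pXn2r _ 2)// ?nnegrE ?soft_abs_ge0 ?addr_ge0//.
rewrite sqr_soft_abs sqrrD real_normK ?num_real//.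
by rewrite lerD2r lerDl mulrn_wge0// mulr_ge0.
Qed.

Lemma soft_abs0 e : 0 <= e -> soft_abs e 0 = e.
Proof.
by move=> e0; apply/eqP; rewrite eq_le soft_abs_ge// (le_trans (soft_abs_le 0 e0))// normr0 add0r.
Qed.

Lemma soft_abs_lip e s t : 0 < e -> `|soft_abs e s - soft_abs e t| <= `|s - t|.
Proof.
move=> e0; have S0 := soft_abs_gt0 s e0; have T0 := soft_abs_gt0 t e0.
have ST : 0 < soft_abs e s + soft_abs e t by exact: addr_gt0.
rewrite -(ler_pM2r ST) -[X in _ * X]gtr0_norm// -normrM -subr_sqr.
rewrite !sqr_soft_abs opprD addrACA subrr addr0 subr_sqr normrM ler_wpM2l//.
by rewrite (le_trans (ler_normD _ _))// lerD// soft_abs_ge_norm.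
Qed.

Lemma of_class_C_soft_abs n k e (f : 'rV[R]_n -> R) : 0 < e -> of_class_C k f ->
  of_class_C k (fun x => soft_abs e (f x)).
Proof.
move=> e0 Cf; apply: of_class_C_powR.
  by move=> x; rewrite ltr_wpDl ?sqr_ge0// exprn_gt0.
apply: of_class_CD; last exact: of_class_C_cst.
by rewrite (_ : (fun x => _) = (fun x => f x * f x))//; exact: of_class_CM.
Qed.

End soft_abs.

(** * The singular kernel *)

Section kernel.
Context (R : realType) (n : nat) (p s : R).
Hypotheses (n_gt0 : (0 < n)%N) (p_gt1 : 1 < p) (s_gt0 : 0 < s).

Local Notation mu := (rV_lebesgue R n).
Local Notation mu2 := (mu \x mu)%E.

Definition kern (z : 'rV[R]_n * 'rV[R]_n) : R :=
  (eucl_norm (z.1 - z.2) `^ (n%:R + p * s))^-1.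

Let p_gt0 : 0 < p. Proof. exact: lt_trans p_gt1. Qed.

Lemma kern_exponent_gt0 : 0 < n%:R + p * s :> R.
Proof. by rewrite ltr_wpDl ?ler0n// mulr_gt0. Qed.

Lemma kern_ge0 z : 0 <= kern z.
Proof. by rewrite invr_ge0 powR_ge0. Qed.

Lemma kernC x y : kern (x, y) = kern (y, x).
Proof.
rewrite /kern /= /eucl_norm; congr (Num.sqrt _ `^ _)^-1.
by apply: eq_bigr => i _; rewrite !mxE -sqrrN opprB.
Qed.

Lemma measurable_eucl_norm_diff :
  measurable_fun setT (fun z : 'rV[R]_n * 'rV[R]_n => eucl_norm (z.1 - z.2)).
Proof.
have mc (i : 'I_n) : measurable_fun setT
    (fun z : 'rV[R]_n * 'rV[R]_n => (z.1 - z.2) ord0 i).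
  rewrite [X in measurable_fun _ X](_ : _ = fun z => rV_coord i z.1 - rV_coord i z.2).
    by apply: measurable_funB; apply: measurableT_comp => //; exact: measurable_rV_coord.
  by apply/funext => z; rewrite !mxE.
rewrite [X in measurable_fun _ X](_ : _ = fun z : 'rV[R]_n * 'rV[R]_n =>
    (\sum_(i < n) (z.1 - z.2) ord0 i ^+ 2) `^ 2^-1); last first.
  by apply/funext => z; rewrite powR12_sqrt// sumr_ge0// => i _; exact: sqr_ge0.
apply: (@measurableT_comp _ _ _ _ _ _ (@powR R ^~ 2^-1)); first exact: measurable_powR.
by apply: measurable_sum => i; apply: measurable_funX.
Qed.

Lemma measurable_kern : measurable_fun setT kern.
Proof.
rewrite /kern; under eq_fun do rewrite -powRN.
exact: (measurableT_comp (@measurable_powR R (- (n%:R + p * s))) measurable_eucl_norm_diff).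
Qed.

Lemma eucl_norm_ge0 (x : 'rV[R]_n) : 0 <= eucl_norm x.
Proof. exact: sqrtr_ge0. Qed.

Lemma eucl_norm_gt0 (x : 'rV[R]_n) : x != 0 -> 0 < eucl_norm x.
Proof.
move=> x0; rewrite lt_neqAle eucl_norm_ge0 andbT eq_sym; apply: contra_neq x0.
rewrite /eucl_norm => /eqP; rewrite sqrtr_eq0 => h; apply/rowP => i; rewrite mxE.
have : \sum_(i < n) x ord0 i ^+ 2 == 0 by rewrite eq_le h sumr_ge0// => j _; exact: sqr_ge0.
rewrite psumr_eq0; last by move=> j _; exact: sqr_ge0.
by move=> /allP/(_ i (mem_index_enum _)) /=; rewrite sqrf_eq0 => /eqP.
Qed.

Lemma eucl_norm_le (x : 'rV[R]_n) d : 0 <= d -> (forall i, `|x ord0 i| <= d) ->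
  eucl_norm x <= n%:R * d.
Proof.
move=> d0 xd; rewrite -(@ler_pXn2r _ 2)// ?nnegrE ?eucl_norm_ge0 ?mulr_ge0//.
rewrite /eucl_norm sqr_sqrtr; last by rewrite sumr_ge0// => j _; exact: sqr_ge0.
apply: (@le_trans _ _ (\sum_(i < n) d ^+ 2)).
  apply: ler_sum => i _; rewrite -[x _ _ ^+ 2]real_normK ?num_real//.
  by rewrite ler_pXn2r// nnegrE.
rewrite sumr_const card_ord -[leLHS]mulr_natl exprMn ler_wpM2r ?sqr_ge0//.
by rewrite expr2 ler_peMr// ler1n.
Qed.

(** The condition [x != y] matters: on the diagonal the inverse of 0 is 0 by convention, so the
    kernel vanishes there. *)
Lemma kern_ge (x y : 'rV[R]_n) d : 0 < d -> x != y ->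
  (forall i, `|x ord0 i - y ord0 i| <= d) ->
  ((n%:R * d) `^ (n%:R + p * s))^-1 <= kern (x, y).
Proof.
move=> d0 xy xyd; have N0 : 0 < eucl_norm (x - y) by rewrite eucl_norm_gt0// subr_eq0.
have nd0 : 0 < n%:R * d by rewrite mulr_gt0// ltr0n.
rewrite /kern /= lef_pV2 ?posrE ?powR_gt0//.
rewrite ler_powR2 ?(ltW N0)// ?(ltW kern_exponent_gt0)//.
by apply: eucl_norm_le => [|i]; [exact: ltW|rewrite !mxE].
Qed.

(** This uniform bound turns the interaction of two subsets of [Omega] into a multiple of the
    product of their measures. *)
Lemma kern_lb (Omega : set 'rV[R]_n) : bounded_set Omega ->
  exists2 k : R, 0 < k & forall x y, Omega x -> Omega y -> x != y -> k <= kern (x, y).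
Proof.
move=> [M [Mreal HM]]; pose d := `|M| + 1.
have d0 : 0 < d by rewrite ltr_wpDl.
exists (((n%:R * (d + d)) `^ (n%:R + p * s))^-1).
  by rewrite invr_gt0 powR_gt0// mulr_gt0 ?ltr0n// addr_gt0.
move=> x y Ox Oy xy; apply: kern_ge => //; first exact: addr_gt0.
have bd z i : Omega z -> `|z ord0 i| <= d.
  move=> Oz; apply: le_trans (HM d _ z Oz); last by rewrite ltr_pwDr// ler_norm.
  by rewrite [leRHS]/Num.norm /= mx_normrE; apply/bigmax_geP; right => /=; exists (ord0, i).
by move=> i; rewrite (le_trans (ler_normB _ _))// lerD// bd.
Qed.

Lemma measurable_cube (x : 'rV[R]_n) d :
  measurable [set y : 'rV[R]_n | forall i, `[x ord0 i - d, x ord0 i + d]%classic (y ord0 i)].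
Proof. by apply: (@measurable_rV_box R n (fun i => `[x ord0 i - d, x ord0 i + d]%classic)). Qed.

Lemma measure_cube (x : 'rV[R]_n) d : 0 < d ->
  mu [set y : 'rV[R]_n | forall i, `[x ord0 i - d, x ord0 i + d]%classic (y ord0 i)] =
  ((d + d) ^+ n)%:E.
Proof.
move=> d0; rewrite (@rV_lebesgue_box R n (fun i => `[x ord0 i - d, x ord0 i + d]%classic))//.
rewrite (eq_bigr (fun=> (d + d)%:E)); last first.
  move=> i _; rewrite lebesgue_measure_itv/= lte_fin.
  have -> : x ord0 i - d < x ord0 i + d by rewrite ltrD2l gtrN.
  by rewrite -EFinD; congr (_%:E); ring.
by rewrite prodEFin prodr_const card_ord.
Qed.

Lemma bounded_measure_lty (Omega : set 'rV[R]_n) : bounded_set Omega ->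
  measurable Omega -> (mu Omega < +oo)%E.
Proof.
move=> [M [Mreal HM]] mO; pose d := `|M| + 1.
have d0 : 0 < d by rewrite ltr_wpDl.
apply: (@le_lt_trans _ _ ((d + d) ^+ n)%:E); last exact: ltry.
rewrite -(measure_cube 0 d0); apply: le_measure; rewrite ?inE//; first exact: measurable_cube.
move=> z Oz i /=; rewrite mxE sub0r add0r in_itv/= -ler_norml.
apply: le_trans (HM d _ z Oz); last by rewrite ltr_pwDr// ler_norm.
by rewrite [leRHS]/Num.norm /= mx_normrE; apply/bigmax_geP; right => /=; exists (ord0, i).
Qed.

(* A point of a set of small measure sees most of any cube centred at it in the
   complement, and the kernel is not integrable near the diagonal. *)
Lemma kern_integral_ge (kappa : R) : exists2 m : R, 0 < m &
  forall A x, measurable A -> (mu A <= m%:E)%E -> A x ->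
  (kappa%:E <= \int[mu]_(y in ~` A) (kern (x, y))%:E)%E.
Proof.
wlog kappa0 : kappa / 0 < kappa.
  move=> W; have [k0|k0] := ltP 0 kappa; first exact: W.
  have [m m0 H] := W 1 ltr01; exists m => // A x mA Am Ax.
  by apply: le_trans (H A x mA Am Ax); rewrite lee_fin (le_trans k0).
have n0 : 0 < n%:R :> R by rewrite ltr0n.
pose c : R := (n%:R `^ (n%:R + p * s))^-1 * 2^-1.
have c0 : 0 < c by rewrite mulr_gt0// invr_gt0// powR_gt0.
have ps0 : 0 < p * s by exact: mulr_gt0.
(* Half the volume of the cube of half-side [d], times the kernel bound (n d)^-(n + p s), equals 2^n
   c d^-(p s). This [d] makes it 2^n kappa, which is at least [kappa]. *)
pose d := (c / kappa) `^ (p * s)^-1.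
have d0 : 0 < d by rewrite powR_gt0// divr_gt0.
have dps : d `^ (p * s) = c / kappa.
  by rewrite -powRrM mulVf ?gt_eqF// powRr1// ltW// divr_gt0.
have dd0 : 0 < (d + d) ^+ n by rewrite exprn_gt0// addr_gt0.
exists ((d + d) ^+ n / 2); first by rewrite divr_gt0.
move=> A x mA Am Ax.
pose Q := [set y : 'rV[R]_n | forall i, `[x ord0 i - d, x ord0 i + d]%classic (y ord0 i)].
have mQ : measurable Q by exact: measurable_cube.
have mk : measurable_fun setT (fun y => (kern (x, y))%:E).
  by apply/measurable_EFinP; apply: (measurableT_comp measurable_kern).
pose k := ((n%:R * d) `^ (n%:R + p * s))^-1.
have k0 : 0 <= k by rewrite invr_ge0 powR_ge0.
apply: (@le_trans _ _ (\int[mu]_(y in Q `\` A) k%:E)%E); last first.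
  apply: (@le_trans _ _ (\int[mu]_(y in Q `\` A) (kern (x, y))%:E)%E).
    apply: ge0_le_integral => //.
    - exact: measurableD.
    - by apply/measurable_funTS.
    - move=> y [Qy Ay]; rewrite lee_fin; apply: kern_ge => //.
        by apply: contra_notN Ay => /eqP <-.
      by move=> i; have := Qy i; rewrite /= in_itv/= distrC ler_distl.
  apply: ge0_subset_integral => //.
  - exact: measurableD.
  - exact: measurableC.
  - by apply/measurable_funTS.
  - by move=> y _; rewrite lee_fin kern_ge0.
rewrite integral_cst; last exact: measurableD.
have QA : (((d + d) ^+ n / 2)%:E <= mu (Q `\` A))%E.
  have : (mu Q <= mu (Q `\` A) + mu A)%E.
    apply: le_trans (measureU2 _ (measurableD mQ mA) mA).
    apply: le_measure; rewrite ?inE//; first exact: measurableU (measurableD mQ mA) mA.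
    by move=> y Qy; have [Ay|nAy] := pselect (A y); [right|left].
  rewrite measure_cube// => H.
  rewrite -(leeD2rE (x := ((d + d) ^+ n / 2)%:E))// -EFinD -splitr.
  by apply: le_trans H _; rewrite leeD2l.
apply: (@le_trans _ _ (k%:E * ((d + d) ^+ n / 2)%:E)%E); last first.
  by rewrite lee_wpmul2l// lee_fin.
rewrite -EFinM lee_fin /k powRM ?(ltW n0) ?(ltW d0)//.
rewrite (@powRD _ d) ?(gt_eqF d0) ?implybT// powR_mulrn ?(ltW d0)// dps.
rewrite -[d + d]mulr2n -[d *+ 2]mulr_natl exprMn.
have dn0 : 0 < d ^+ n by exact: exprn_gt0.
have -> : (n%:R `^ (n%:R + p * s) * (d ^+ n * (c / kappa)))^-1 * (2%:R ^+ n * d ^+ n / 2)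
   = 2 ^+ n * kappa.
  rewrite /c; field; rewrite ?gt_eqF//= ?powR_gt0//.
by rewrite ler_peMl ?(ltW kappa0)// exprn_ege1// ler1n.
Qed.

Lemma negligible_fst (N : set 'rV[R]_n) : mu.-negligible N ->
  mu2.-negligible [set z | N z.1].
Proof.
move=> [A [mA A0 NA]]; exists (A `*` setT); split.
- exact: measurableX.
- by transitivity (mu A * mu setT)%E; [exact: product_measure1E|rewrite A0 mul0e].
- by move=> z Nz; split => //; exact: NA.
Qed.

Lemma negligible_snd (N : set 'rV[R]_n) : mu.-negligible N ->
  mu2.-negligible [set z | N z.2].
Proof.
move=> [A [mA A0 NA]]; exists (setT `*` A); split.
- exact: measurableX.
- by transitivity (mu setT * mu A)%E; [exact: product_measure1E|rewrite A0 mule0].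
- by move=> z Nz; split => //; exact: NA.
Qed.

Lemma ae_fst (P : 'rV[R]_n -> Prop) : {ae mu, forall x, P x} ->
  {ae mu2, forall z, P z.1}.
Proof. exact: negligible_fst. Qed.

Lemma ae_snd (P : 'rV[R]_n -> Prop) : {ae mu, forall x, P x} ->
  {ae mu2, forall z, P z.2}.
Proof. exact: negligible_snd. Qed.

Lemma continuous_measurable_rV (f : 'rV[R]_n -> R) : continuous f ->
  measurable_fun setT f.
Proof.
move=> cf; apply: (measurability _ (RGenOpens.measurableE R)).
move=> _ [_ [a [b ->] <-]]; rewrite setTI; apply: rV_open_measurable.
by apply: open_comp => [x _|]; [exact: cf|exact: interval_open].
Qed.

Lemma measurable_diff (f : 'rV[R]_n -> R) : measurable_fun setT f ->
  measurable_fun setT (fun z : 'rV[R]_n * 'rV[R]_n => f z.1 - f z.2).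
Proof.
by move=> mf; apply: measurable_funB; apply: measurableT_comp.
Qed.

Lemma measurable_sublevel (u : 'rV[R]_n -> R) (e : R) : measurable_fun setT u ->
  measurable [set x : 'rV[R]_n | u x < e].
Proof.
move=> mu'; rewrite (_ : [set x | _] = setT `&` u @^-1` `]-oo, e[); first exact: mu'.
by rewrite setTI; apply/seteqP; split => x /=; rewrite in_itv.
Qed.

Lemma measurable_superlevel (u : 'rV[R]_n -> R) (e : R) : measurable_fun setT u ->
  measurable [set x : 'rV[R]_n | e < u x].
Proof.
move=> mu'; rewrite (_ : [set x | _] = setT `&` u @^-1` `]e, +oo[); first exact: mu'.
by rewrite setTI; apply/seteqP; split => x /=; rewrite in_itv/= andbT.
Qed.

Lemma measurable_level_set (u v : 'rV[R]_n -> R) (a b : R) :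
  measurable_fun setT u -> measurable_fun setT v ->
  measurable ([set x | u x = a] `&` [set x | b <= v x]).
Proof.
move=> mu' mv; apply: measurableI.
  rewrite (_ : [set x | _] = setT `&` u @^-1` [set a]); last by rewrite setTI.
  exact: mu'.
rewrite (_ : [set x | _] = setT `&` v @^-1` `[b, +oo[); first exact: mv.
by rewrite setTI; apply/seteqP; split => x /=; rewrite in_itv/= andbT.
Qed.

End kernel.

(** * Dominated convergence, powers and double integrals *)

Section integration.
Context d (T : measurableType d) (R : realType) (m : {measure set T -> \bar R}).
Implicit Types (f : T -> R) (g : T -> \bar R).

Lemma ae_dominated_integrable f g : measurable_fun setT f -> m.-integrable setT g ->
  {ae m, forall x, (`|f x|%:E <= g x)%E} -> m.-integrable setT (EFin \o f).
Proof.
move=> mf ig fg; have /integrableP[mg goo] := ig.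
apply/integrableP; split; first exact/measurable_EFinP.
apply: le_lt_trans goo; apply: ae_ge0_le_integral => //.
- by apply: measurableT_comp => //; exact/measurable_EFinP.
- exact: measurableT_comp.
- by apply: filterS fg => x h _ /=; apply: le_trans h _; exact: lee_abs.
Qed.

(** The Riesz-Fischer argument: the sum of all [f k] has integral at most 1, so it is a common
    majorant, and it is finite almost everywhere, so its terms tend to 0. *)
Lemma summable_dominated (f : nat -> T -> R) :
  (forall k, measurable_fun setT (f k)) -> (forall k x, 0 <= f k x) ->
  (forall k, (\int[m]_x (f k x)%:E <= (1 / (2 ^ k.+1)%:R)%:E)%E) ->
  exists2 g, m.-integrable setT g & (forall x k, ((f k x)%:E <= g x)%E) /\
    {ae m, forall x, f k x @[k --> \oo] --> 0}.
Proof.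
move=> mf f0 fle; pose g x := (\sum_(k <oo) (f k x)%:E)%E.
have f0E k x : (0 <= (f k x)%:E)%E by rewrite lee_fin.
have mfE k : measurable_fun setT (fun x => (f k x)%:E) by exact/measurable_EFinP.
have ig : m.-integrable setT g.
  apply/integrableP; split; first exact: ge0_emeasurable_sum.
  under eq_integral => x _ do rewrite gee0_abs ?nneseries_ge0//.
  rewrite integral_nneseries//.
  apply: (@le_lt_trans _ _ 1%:E); last exact: ltry.
  apply: le_trans (epsilon_trick0 xpredT (@ler01 R)).
  by apply: lee_nneseries => // *; apply: integral_ge0.
exists g => //; split.
  move=> x k; apply: le_trans (@nneseries_lim_ge R _ xpredT 0 k.+1 _) => //.
  by rewrite big_nat_recr//= leeDr// sume_ge0.
apply: filterS (integrable_ae measurableT ig) => x /(_ I) gx.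
apply: cvg_series_cvg_0; apply: nondecreasing_is_cvgn.
  apply/nondecreasing_seqP => k; rewrite /series/= big_nat_recr//=.
  by rewrite lerDl.
exists (fine (g x)) => _ [k _ <-]; rewrite -lee_fin fineK// /series/= -sumEFin.
exact: nneseries_lim_ge.
Qed.

End integration.

Section powR_continuity.
Context (R : realType).

Lemma norm_powR_lip (q M a b : R) : 1 <= q -> `|a| <= M -> `|b| <= M ->
  `| `|a| `^ q - `|b| `^ q| <= q * M `^ (q - 1) * `|a - b|.
Proof.
move=> q1 aM bM; have q0 : 0 < q by exact: lt_le_trans q1.
apply: (@le_trans _ _ (q * M `^ (q - 1) * `| `|a| - `|b| |)); last first.
  by rewrite ler_wpM2l ?ler_dist_dist// mulr_ge0 ?powR_ge0// ltW.
(* The mean value bound needs positive bases; this covers the case where one base is 0. *)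
have zero c : 0 < c -> c <= M -> c `^ q <= q * M `^ (q - 1) * c.
  move=> c0 cM; rewrite -(@mulr_powRB1 _ c q (ltW c0) q0) mulrC ler_wpM2r ?(ltW c0)//.
  apply: (@le_trans _ _ (M `^ (q - 1))); first by rewrite ler_powR2 ?subr_ge0// ltW.
  by rewrite ler_peMl ?powR_ge0.
have [a0|a0] := ltP 0 `|a|; last first.
  have -> : `|a| = 0 by apply/eqP; rewrite eq_le a0 normr_ge0.
  rewrite powR0 ?gt_eqF// !sub0r !normrN normr_id (ger0_norm (powR_ge0 _ _)).
  have [b0|b0] := ltP 0 `|b|; first exact: zero.
  have -> : `|b| = 0 by apply/eqP; rewrite eq_le b0 normr_ge0.
  by rewrite powR0 ?gt_eqF// mulr0.
have [b0|b0] := ltP 0 `|b|; last first.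
  have -> : `|b| = 0 by apply/eqP; rewrite eq_le b0 normr_ge0.
  by rewrite powR0 ?gt_eqF// !subr0 normr_id (ger0_norm (powR_ge0 _ _)) zero.
by apply: powR_lip_ge1; rewrite // ?a0 ?b0.
Qed.

Lemma cvg_norm_powR (q : R) (u : nat -> R) (l : R) : 1 <= q ->
  u k @[k --> \oo] --> l -> `|u k| `^ q @[k --> \oo] --> `|l| `^ q.
Proof.
move=> q1 ul; pose M := `|l| + 1; pose C := q * M `^ (q - 1).
have q0 : 0 < q by exact: lt_le_trans q1.
have M0 : 0 < M by rewrite ltr_wpDl.
have C0 : 0 < C by rewrite mulr_gt0// powR_gt0.
apply/cvgrPdist_lt => e e0.
have /cvgrPdist_lt ul' := ul.
near=> k.
have lk1 : `|l - u k| < 1 by near: k; exact: ul'.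
have lke : `|l - u k| < e / C by near: k; apply: ul'; rewrite divr_gt0.
apply: (@le_lt_trans _ _ (C * `|l - u k|)).
  apply: norm_powR_lip => //; first by rewrite lerDl.
  by rewrite -[u k](subrKC l) -opprB (le_trans (ler_normB _ _))// lerD2l ltW// distrC.
by rewrite mulrC -ltr_pdivlMr.
Unshelve. all: by end_near. Qed.

Lemma measurable_norm_powR d (T : measurableType d) (q : R) (f : T -> R) :
  measurable_fun setT f -> measurable_fun setT (fun x => `|f x| `^ q).
Proof.
move=> mf; apply: (measurableT_comp (@measurable_powR R q)).
exact: measurableT_comp.
Qed.

End powR_continuity.

Section square_integrals.
Context d (T : measurableType d) (R : realType)
  (m : {sigma_finite_measure set T -> \bar R}).

Lemma integral_swap (f : T * T -> \bar R) : measurable_fun setT f ->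
  (forall z, 0 <= f z)%E ->
  (\int[m \x m]_z f (z.2, z.1) = \int[m \x m]_z f z)%E.
Proof.
move=> mf f0; rewrite fubini_tonelli1//; last first.
  exact: (measurableT_comp mf (@measurable_swap _ _ T T)).
by rewrite [RHS]fubini_tonelli2.
Qed.

Lemma measurable_integral_section (f : T * T -> R) : measurable_fun setT f ->
  (forall z, 0 <= f z) ->
  measurable_fun setT (fun x => \int[m]_y (f (x, y))%:E)%E.
Proof.
move=> mf f0; apply: (@measurable_fun_fubini_tonelli_F _ _ _ _ _ m (EFin \o f)).
  exact/measurable_EFinP.
by move=> z; rewrite lee_fin.
Qed.

Lemma integral_sections_le (D : set T) (f : T * T -> R) : measurable D ->
  measurable_fun setT f -> (forall z, 0 <= f z) ->
  (\int[m]_(x in D) \int[m]_y (f (x, y))%:E <= \int[m \x m]_z (f z)%:E)%E.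
Proof.
move=> mD mf f0; have mfE : measurable_fun setT (fun z => (f z)%:E) by exact/measurable_EFinP.
have f0E z : (0 <= (f z)%:E)%E by rewrite lee_fin.
rewrite [leRHS](@fubini_tonelli1 _ _ _ _ _ m m _ mfE f0E).
apply: ge0_subset_integral => //; first exact: measurable_integral_section.
by move=> x _; exact: integral_ge0.
Qed.

End square_integrals.

(** * Limits of test functions *)

Section test_limits.
Context (R : realType) (n : nat) (p s q : R) (Omega : set 'rV[R]_n).
Hypotheses (n_gt0 : (0 < n)%N) (p_gt1 : 1 < p) (s_gt0 : 0 < s)
  (q_gt1 : 1 < q) (q_le_p : q <= p)
  (Omega_open : open Omega) (Omega_bounded : bounded_set Omega).
Implicit Types (u v phi : 'rV[R]_n -> R) (psi : nat -> 'rV[R]_n -> R).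

Local Notation mu := (rV_lebesgue R n).
Local Notation mu2 := (mu \x mu)%E.

Let p_gt0 : 0 < p. Proof. exact: lt_trans p_gt1. Qed.
Let q_gt0 : 0 < q. Proof. exact: lt_trans q_gt1. Qed.
Let mO : measurable Omega. Proof. exact: rV_open_measurable. Qed.

Definition energy_density u (z : 'rV[R]_n * 'rV[R]_n) : R :=
  `|u z.1 - u z.2| `^ p * kern p s z.

Definition pairing u v (z : 'rV[R]_n * 'rV[R]_n) : R :=
  signed_pow p (u z.1 - u z.2) * (v z.1 - v z.2) * kern p s z.

(* Unlike norm convergence, this is preserved by composition with Lipschitz
   functions for trivial reasons, and it is all that dominated convergence needs. *)
Definition test_limit v psi : Prop :=
  [/\ forall k, test_function Omega (psi k),
      measurable_fun setT v,
      {ae mu, forall x, psi k x @[k --> \oo] --> v x},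
      exists2 g, mu.-integrable setT g &
        {ae mu, forall x k, ((`|psi k x| `^ p)%:E <= g x)%E} &
      exists2 g, mu2.-integrable setT g &
        {ae mu2, forall z k, ((energy_density (psi k) z)%:E <= g z)%E}].

Lemma energyE u : energy s p u = (\int[mu2]_z (energy_density u z)%:E)%E.
Proof. by []. Qed.

Lemma energy_density_ge0 u z : 0 <= energy_density u z.
Proof. by rewrite mulr_ge0 ?powR_ge0 ?kern_ge0. Qed.

Lemma measurable_energy_density u : measurable_fun setT u ->
  measurable_fun setT (energy_density u).
Proof.
move=> mu'; apply: measurable_funM; last exact: measurable_kern.
exact: measurable_norm_powR (measurable_diff mu').
Qed.

Lemma measurable_pairing u v : measurable_fun setT u -> measurable_fun setT v ->
  measurable_fun setT (pairing u v).
Proof.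
move=> mu' mv; apply: measurable_funM; last exact: measurable_kern.
apply: measurable_funM; last exact: measurable_diff.
apply: measurable_funM; last exact: measurable_diff.
exact: measurable_norm_powR (measurable_diff mu').
Qed.

Lemma measurable_test_function phi : test_function Omega phi -> measurable_fun setT phi.
Proof. by move=> /test_function_continuous /continuous_measurable_rV. Qed.

Lemma pairing_le u v z : `|pairing u v z| <= energy_density u z + energy_density v z.
Proof.
rewrite normrM (ger0_norm (kern_ge0 _ _ _)) -mulrDl ler_wpM2r ?kern_ge0//.
exact: signed_pow_young.
Qed.

Lemma test_limit_eq0 v psi : test_limit v psi ->
  {ae mu, forall x, ~ Omega x -> v x = 0}.
Proof.
move=> [tpsi _ cpsi _ _]; apply: filterS cpsi => x psix nOx.
exact: test_functions_cvg_eq0 tpsi nOx psix.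
Qed.

Lemma test_limit_diff v psi : test_limit v psi ->
  {ae mu2, forall z, psi k z.1 - psi k z.2 @[k --> \oo] --> v z.1 - v z.2}.
Proof.
move=> [_ _ cpsi _ _]; apply: filterS2 (ae_fst cpsi) (ae_snd cpsi) => z.
exact: cvgB.
Qed.

Lemma test_limit_energy v psi : test_limit v psi ->
  mu2.-integrable setT (EFin \o energy_density v) /\
  energy s p (psi k) @[k --> \oo] --> energy s p v.
Proof.
move=> tl; have [tpsi mv cpsi _ [g ig psig]] := tl.
have [] := @dominated_convergence _ _ _ mu2 setT measurableT
  (fun k => EFin \o energy_density (psi k)) (EFin \o energy_density v) g.
- move=> k; apply/measurable_EFinP; apply: measurable_energy_density.
  exact: measurable_test_function (tpsi k).
- by apply/measurable_EFinP; exact: measurable_energy_density.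
- apply: filterS (test_limit_diff tl) => z vz _.
  apply: cvg_EFin; first by near=> k.
  by apply: cvgMl; apply: cvg_norm_powR => //; exact: ltW.
- exact: ig.
- by apply: filterS psig => z gz k _ /=; rewrite ger0_norm ?energy_density_ge0.
- by move=> iv _ cv; split.
Unshelve. all: by end_near. Qed.

Lemma test_limit_Lp v psi : test_limit v psi ->
  mu.-integrable setT (fun x => (`|v x| `^ p)%:E).
Proof.
move=> [tpsi mv cpsi [g ig psig] _].
apply: (@ae_dominated_integrable _ _ _ _ (fun x => `|v x| `^ p) g) => //.
  exact: measurable_norm_powR.
apply: filterS2 cpsi psig => x vx gx; rewrite ger0_norm ?powR_ge0//.
have : (`|psi k x| `^ p)%:E @[k --> \oo] --> (`|v x| `^ p)%:E.
  apply: cvg_EFin; first by near=> k.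
  by apply: cvg_norm_powR => //; exact: ltW.
by apply: cvge_le; near=> k; exact: gx.
Unshelve. all: by end_near. Qed.

Lemma integrable_Omega_cst (c : R) : mu.-integrable Omega (EFin \o cst c).
Proof.
apply: measurable_bounded_integrable => //; first exact: bounded_measure_lty.
exact: bounded_cst.
Qed.

Lemma Lp_integrable_powR v (r : R) : 0 <= r <= p -> measurable_fun setT v ->
  mu.-integrable setT (fun x => (`|v x| `^ p)%:E) ->
  mu.-integrable Omega (fun x => (`|v x| `^ r)%:E).
Proof.
move=> /andP[r0 rp] mv iv.
apply: (@le_integrable _ _ _ mu _ mO _ (fun x => (1 + `|v x| `^ p)%:E)).
- by apply/measurable_EFinP; apply: measurable_funTS; exact: measurable_norm_powR.
- move=> x _; rewrite /= lee_fin (ger0_norm (powR_ge0 _ _)) [leRHS]ger0_norm ?addr_ge0 ?powR_ge0//.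
  exact: powR_le1D.
- under eq_fun do rewrite EFinD.
  apply: (integrableD mO (integrable_Omega_cst 1)).
  exact: integrableS iv.
Qed.

Lemma test_limit_Lq v psi : test_limit v psi ->
  (\int[mu]_(x in Omega) (`|psi k x| `^ q)%:E @[k --> \oo] -->
   \int[mu]_(x in Omega) (`|v x| `^ q)%:E)%E.
Proof.
move=> [tpsi mv cpsi [g ig psig] _].
have [] := @dominated_convergence _ _ _ mu Omega mO
  (fun k x => (`|psi k x| `^ q)%:E) (fun x => (`|v x| `^ q)%:E)
  (fun x => 1%:E + g x)%E.
- move=> k; apply/measurable_EFinP; apply: measurable_funTS.
  apply: measurable_norm_powR; exact: measurable_test_function (tpsi k).
- by apply/measurable_EFinP; apply: measurable_funTS; exact: measurable_norm_powR.
- apply: filterS cpsi => x vx _; apply: cvg_EFin; first by near=> k.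
  by apply: cvg_norm_powR => //; exact: ltW.
- apply: (integrableD mO (integrable_Omega_cst 1)); exact: integrableS ig.
- apply: filterS psig => x gx k _ /=; rewrite ger0_norm ?powR_ge0//.
  apply: (@le_trans _ _ (1 + `|psi k x| `^ p)%:E).
    by rewrite lee_fin powR_le1D// ltW.
  by rewrite EFinD leeD2l.
- by move=> _ _ cv.
Unshelve. all: by end_near. Qed.

Lemma Lp_normE u : Lp_norm Omega q u = 1%E <->
  (\int[mu]_(x in Omega) (`|u x| `^ q)%:E = 1)%E.
Proof.
have E : (\int[mu]_x (`|(EFin \o (u \_ Omega)) x| `^ q) =
    \int[mu]_(x in Omega) (`|u x| `^ q)%:E)%E.
  rewrite [RHS]integral_mkcond; apply: eq_integral => x _ /=.
  by rewrite !patchE; case: ifP => // _; rewrite normr0 powR0// gt_eqF.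
have qN : q != 0 by rewrite gt_eqF.
split => [N1|I1].
  by rewrite -E -poweR_Lnorm// [X in (X `^ _)%E](N1 : _ = _) poweR1r.
by rewrite /Lp_norm unlock E I1 poweR1r.
Qed.

Lemma energyZ (c : R) u : measurable_fun setT u ->
  energy s p (fun x => c * u x) = ((`|c| `^ p)%:E * energy s p u)%E.
Proof.
move=> mu'; rewrite !energyE -ge0_integralZl_EFin//.
- apply: eq_integral => z _; rewrite -EFinM; congr (_%:E).
  by rewrite /energy_density -mulrBr normrM powRM// mulrA.
- by move=> z _; rewrite lee_fin energy_density_ge0.
- by apply/measurable_EFinP; exact: measurable_energy_density.
Qed.

(** Dividing [phi] by a^(1/q) makes it admissible for the infimum. The homogeneous form is needed
    because the approximants of a normalized function are only nearly normalized. *)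
Lemma Lambda_le_test phi (L a : R) : (L%:E <= Lambda s p q Omega)%E ->
  test_function Omega phi -> 0 < a ->
  (\int[mu]_(x in Omega) (`|phi x| `^ q)%:E = a%:E)%E ->
  ((L * a `^ (p / q))%:E <= energy s p phi)%E.
Proof.
move=> LL tphi a0 Ia; have mphi := measurable_test_function tphi.
pose c := (a `^ q^-1)^-1; have c0 : 0 < c by rewrite invr_gt0 powR_gt0.
have cq : c `^ q = a^-1.
  by rewrite /c powRV ?powR_ge0// -powRrM mulVf ?gt_eqF// powRr1// ltW.
have cp : c `^ p = (a `^ (p / q))^-1.
  by rewrite /c powRV ?powR_ge0// -powRrM mulrC.
have : (L%:E <= energy s p (fun x => (c * phi x)%R))%E.
  apply: le_trans LL _; apply: ereal_inf_lbound; exists (fun x => (c * phi x)%R) => //.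
  split; first exact: test_functionZ.
  apply/Lp_normE; rewrite (eq_integral (fun x => (c `^ q)%:E * (`|phi x| `^ q)%:E)%E); last first.
    by move=> x _; rewrite -EFinM normrM (gtr0_norm c0) powRM// ltW.
  rewrite ge0_integralZl_EFin ?powR_ge0//; last first.
    by apply/measurable_EFinP; apply: measurable_funTS; exact: measurable_norm_powR.
  by rewrite Ia -EFinM cq mulVf// gt_eqF.
rewrite energyZ// (gtr0_norm c0) cp => H.
have P0 : 0 < a `^ (p / q) by rewrite powR_gt0.
have := lee_wpmul2r (ltW (_ : 0 < (a `^ (p / q))%:E)%E) H.
rewrite lte_fin => /(_ P0); rewrite muleAC -!EFinM mulVf ?gt_eqF// mul1e.
exact.
Qed.

Lemma Lambda_le_test_limit v psi (L : R) : (L%:E <= Lambda s p q Omega)%E ->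
  test_limit v psi -> (\int[mu]_(x in Omega) (`|v x| `^ q)%:E = 1)%E ->
  (L%:E <= energy s p v)%E.
Proof.
move=> LL tl v1; have [tpsi _ _ _ _] := tl.
have [_ cE] := test_limit_energy tl.
have := test_limit_Lq tl; rewrite v1 => /fine_cvgP[afin ca].
pose a k := fine (\int[mu]_(x in Omega) (`|psi k x| `^ q)%:E)%E.
have cL : (L * `|a k| `^ (p / q))%:E @[k --> \oo] --> L%:E.
  apply: cvg_EFin; first by near=> k.
  have := @cvg_norm_powR R (p / q) a 1; rewrite normr1 powR1 => H.
  rewrite -[X in _ --> X]mulr1; apply: cvgMr; apply: H => //.
  by rewrite ler_pdivlMr// mul1r.
apply: lee_cvg_to cL cE _; near=> k.
have ak0 : 0 < a k by near: k; apply: (cvgr_gt _ ca).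
rewrite (gtr0_norm ak0); apply: Lambda_le_test => //.
by rewrite /a fineK//; near: k.
Unshelve. all: by end_near. Qed.

End test_limits.

(** * From the completion to dominated limits of test functions *)

Section completion.
Context (R : realType) (n : nat) (p s q : R) (Omega : set 'rV[R]_n).
Hypotheses (n_gt0 : (0 < n)%N) (p_gt1 : 1 < p) (s_gt0 : 0 < s)
  (q_gt1 : 1 < q) (q_le_p : q <= p)
  (Omega_open : open Omega) (Omega_bounded : bounded_set Omega).
Implicit Types (u v phi : 'rV[R]_n -> R) (psi : nat -> 'rV[R]_n -> R).

Local Notation mu := (rV_lebesgue R n).
Local Notation mu2 := (mu \x mu)%E.

Let p_gt0 : 0 < p. Proof. exact: lt_trans p_gt1. Qed.
Let q_gt0 : 0 < q. Proof. exact: lt_trans q_gt1. Qed.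
Let mO : measurable Omega. Proof. exact: rV_open_measurable. Qed.

(** Dominated convergence on both sides of the equation. Young's inequality bounds the left
    integrand by the sum of the energy densities and the right one by a multiple of |u|^q + 1 + |psi
    k|^p, integrable on [Omega] because its measure is finite. *)
Lemma weak_solution_test_limit (lambda : R) u v psi : measurable_fun setT u ->
  mu2.-integrable setT (EFin \o energy_density p s u) ->
  mu.-integrable setT (fun x => (`|u x| `^ p)%:E) ->
  weak_solution s p Omega (fun x => lambda * (`|u x| `^ (q - 2) * u x)) u ->
  test_limit p s Omega v psi ->
  [/\ mu2.-integrable setT (EFin \o pairing p s u v),
      mu.-integrable Omega (fun x => (lambda * signed_pow q (u x) * v x)%:E) &
      (\int[mu2]_z (pairing p s u v z)%:E =
       \int[mu]_(x in Omega) (lambda * signed_pow q (u x) * v x)%:E)%E].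
Proof.
move=> mu' iE iu wu tl; have [tpsi mv cpsi [g0 ig0 g0psi] [g ig gpsi]] := tl.
have mpsi k := measurable_test_function (tpsi k).
have [] := @dominated_convergence _ _ _ mu2 setT measurableT
  (fun k => EFin \o pairing p s u (psi k)) (EFin \o pairing p s u v)
  (fun z => ((EFin \o energy_density p s u) z + g z)%E).
- by move=> k; apply/measurable_EFinP; exact: measurable_pairing.
- by apply/measurable_EFinP; exact: measurable_pairing.
- apply: filterS (test_limit_diff tl) => z vz _.
  apply: cvg_EFin; first by near=> k.
  by apply: cvgMl; apply: cvgMr.
- exact: (integrableD measurableT iE ig).
- apply: filterS gpsi => z gz k _ /=.
  apply: (@le_trans _ _ (energy_density p s u z + energy_density p s (psi k) z)%:E).
    by rewrite lee_fin pairing_le.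
  by rewrite EFinD leeD2l.
move=> iP _ cP.
have [] := @dominated_convergence _ _ _ mu Omega mO
  (fun k x => (lambda * signed_pow q (u x) * psi k x)%:E)
  (fun x => (lambda * signed_pow q (u x) * v x)%:E)
  (fun x => (`|lambda|%:E * ((`|u x| `^ q)%:E + (1%:E + g0 x)))%E).
- move=> k; apply/measurable_EFinP; apply: measurable_funTS.
  apply: measurable_funM => //; apply: measurable_funM => //.
  by apply: measurable_funM => //; exact: measurable_norm_powR.
- apply/measurable_EFinP; apply: measurable_funTS.
  apply: measurable_funM => //; apply: measurable_funM => //.
  by apply: measurable_funM => //; exact: measurable_norm_powR.
- apply: filterS cpsi => x vx _; apply: cvg_EFin; first by near=> k.
  exact: cvgMr.
- apply: integrableZl => //.
  apply: (integrableD mO).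
    by apply: (Lp_integrable_powR _ _ _ mu' iu) => //; rewrite ltW.
  apply: (integrableD mO (integrable_Omega_cst Omega_open Omega_bounded 1)).
  exact: integrableS ig0.
- apply: filterS g0psi => x gx k _ /=.
  apply: (@le_trans _ _ (`|lambda| * (`|u x| `^ q + (1 + `|psi k x| `^ p)))%:E).
    rewrite lee_fin -mulrA normrM ler_wpM2l//.
    apply: le_trans (signed_pow_young _ _ q_gt1) _; rewrite lerD2l.
    by rewrite powR_le1D// ltW.
  by rewrite EFinM lee_wpmul2l// EFinD leeD2l// EFinD leeD2l.
move=> iF _ cF; split => //.
have E k : (\int[mu2]_z (EFin \o pairing p s u (psi k)) z =
    \int[mu]_(x in Omega) (lambda * signed_pow q (u x) * psi k x)%:E)%E.
  exact: wu (tpsi k).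
have cF' : (fun k => \int[mu2]_z (EFin \o pairing p s u (psi k)) z)%E @ \oo -->
    (\int[mu]_(x in Omega) (lambda * signed_pow q (u x) * v x)%:E)%E.
  by rewrite (funext E).
exact: cvg_unique cP cF'.
Unshelve. all: by end_near. Qed.

Lemma ereal_cvg0_lt (f : nat -> \bar R) (e : R) : f k @[k --> \oo] --> 0%E -> 0 < e ->
  \forall k \near \oo, (f k < e%:E)%E.
Proof.
move=> /fine_cvgP[ffin f0] e0; near=> k.
have fk : f k \is a fin_num by near: k.
by rewrite -(fineK fk) lte_fin; near: k; exact: (cvgr_lt _ f0).
Unshelve. all: by end_near. Qed.

Lemma poweR_inv_lt (x : \bar R) (e : R) : (0 <= x)%E -> 0 < e ->
  (x `^ p^-1 < (e `^ p^-1)%:E)%E -> (x <= e%:E)%E.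
Proof.
move=> x0 e0 xe; have x1 : (x = (x `^ p^-1) `^ p)%E.
  by rewrite -poweRrM mulVf ?gt_eqF// poweRe1.
have e1 : (e%:E = (e `^ p^-1)%:E `^ p)%E.
  by rewrite poweR_EFin -powRrM mulVf ?gt_eqF// powRr1// ltW.
rewrite x1 e1; apply: gt0_ler_poweR; first exact: ltW.
- by rewrite in_itv/= leey poweR_ge0.
- by rewrite in_itv/= leey lee_fin powR_ge0.
- exact: ltW.
Qed.

Lemma difference_quotientE u z :
  `|difference_quotient s p u z| `^ p = energy_density p s u z.
Proof.
rewrite /difference_quotient normrM (ger0_norm (_ : 0 <= (_ `^ _)^-1)); last first.
  by rewrite invr_ge0 powR_ge0.
rewrite powRM ?invr_ge0 ?powR_ge0// powRV ?powR_ge0// -powRrM.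
rewrite /energy_density /kern; congr (_ * (_ `^ _)^-1).
by field; rewrite gt_eqF.
Qed.

(** Membership in the space gives measurability of [u] only on [Omega]. On the whole space, [u] is
    recovered from the section of its difference quotient at a fixed point of [Omega]. *)
Lemma V_space_measurable u : Omega !=set0 -> V_space s p Omega u ->
  measurable_fun setT u.
Proof.
move=> [x0 Ox0] [_ [mdq _]].
have mpair : measurable_fun setT (fun y : 'rV[R]_n => (x0, y)) by exact: measurable_pair1.
have m1 : measurable_fun setT (fun y => difference_quotient s p u (x0, y)).
  apply: (measurable_comp _ _ mdq mpair); first exact: measurableX.
  by move=> _ [y _ <-]; split.
have m2 : measurable_fun setT (fun y : 'rV[R]_n => eucl_norm (x0 - y) `^ (n%:R / p + s)).
  apply: (measurableT_comp (@measurable_powR R (n%:R / p + s))).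
  exact: (measurableT_comp (@measurable_eucl_norm_diff R n) mpair).
rewrite (_ : u = fun y => u x0 - difference_quotient s p u (x0, y) *
    eucl_norm (x0 - y) `^ (n%:R / p + s)).
  by apply: measurable_funB => //; exact: measurable_funM.
apply/funext => y; rewrite /difference_quotient /=.
have [<-|xy] := eqVneq x0 y; first by rewrite subrr mul0r mul0r subr0.
rewrite divfK; first by rewrite subKr.
by rewrite gt_eqF// powR_gt0 ?eucl_norm_gt0 ?subr_eq0.
Qed.

(** Along a subsequence whose errors are at most 1/2^(k+1), the errors have integrable majorants.
    Adding those of [u] itself, with the factor 2^p, dominates the test functions. *)
Lemma V0_space_test_limit u : Omega !=set0 -> V0_space s p Omega u ->
  exists psi, test_limit p s Omega u psi.
Proof.
move=> O0 [Vu [phi [tphi Ephi Nphi]]].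
have mu' := V_space_measurable O0 Vu.
have mphi k := measurable_test_function (tphi k).
have mB k : measurable_fun setT (u \- phi k) by exact: measurable_funB.
have iB k : (\int[mu]_x (`|u x - phi k x| `^ p)%:E =
    'N[mu]_p%:E[EFin \o (u \- phi k)%R] `^ p)%E.
  by rewrite poweR_Lnorm// gt_eqF.
have /choice[j jP] k : exists j, (energy s p (u \- phi j)%R <= (1 / (2 ^ k.+1)%:R)%:E)%E /\
    (\int[mu]_x (`|u x - phi j x| `^ p)%:E <= (1 / (2 ^ k.+1)%:R)%:E)%E.
  have e0 : 0 < 1 / (2 ^ k.+1)%:R :> R by rewrite divr_gt0// ltr0n expn_gt0.
  have e1 : 0 < (1 / (2 ^ k.+1)%:R) `^ p^-1 :> R by rewrite powR_gt0.
  have : \forall j \near \oo, (energy s p (u \- phi j)%R <= (1 / (2 ^ k.+1)%:R)%:E)%E /\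
    (\int[mu]_x (`|u x - phi j x| `^ p)%:E <= (1 / (2 ^ k.+1)%:R)%:E)%E.
    near=> j; split.
      apply: poweR_inv_lt => //; first by apply: integral_ge0 => z _; rewrite lee_fin energy_density_ge0.
      by near: j; exact: ereal_cvg0_lt Ephi e1.
    apply: poweR_inv_lt => //; first by apply: integral_ge0 => z _; rewrite lee_fin powR_ge0.
    rewrite iB -poweRrM divff ?gt_eqF// poweRe1 ?Lnorm_ge0//.
    by near: j; exact: ereal_cvg0_lt Nphi e1.
  by move=> [N _ /(_ N (leqnn N))]; exists N.
pose psi k := phi (j k).
have [g0 ig0 [g0le g0cv]] := @summable_dominated _ _ R mu
  (fun k x => `|u x - psi k x| `^ p)
  (fun k => measurable_norm_powR p (mB (j k))) (fun k x => powR_ge0 _ _) (fun k => (jP k).2).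
have [g ig [gle _]] := @summable_dominated _ _ R mu2
  (fun k => energy_density p s (u \- psi k))
  (fun k => measurable_energy_density p s (mB (j k)))
  (fun k x => energy_density_ge0 _ _ _ _) (fun k => (jP k).1).
have cpsi : {ae mu, forall x, psi k x @[k --> \oo] --> u x}.
  apply: filterS g0cv => x /cvgrPdist_lt h; apply/cvgrPdist_lt => e e0.
  have /h : 0 < e `^ p by rewrite powR_gt0.
  apply: filterS => k; rewrite sub0r normrN (ger0_norm (powR_ge0 _ _)) => hk.
  rewrite ltNge; apply: contraTN hk => ek; rewrite -leNgt.
  by rewrite ler_powR2// ltW.
have u0 : {ae mu, forall x, ~ Omega x -> u x = 0}.
  apply: filterS cpsi => x psix nOx.
  exact: test_functions_cvg_eq0 (fun k => tphi (j k)) nOx psix.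
have [[_ Nu] [mdq Ndq]] := Vu.
have iu : mu.-integrable setT (fun x => (`|u x| `^ p)%:E).
  apply: (@ae_dominated_integrable _ _ _ _ (fun x => `|u x| `^ p)
    (fun x => (`|(u \_ Omega) x| `^ p)%:E)); first exact: measurable_norm_powR.
    apply/integrableP; split.
      apply/measurable_EFinP; apply: measurable_norm_powR.
      by apply/(measurable_restrictT _ _).1 => //; apply: measurable_funTS.
    rewrite (_ : (\int[_]_x _)%E = ('N[mu]_p%:E[EFin \o (u \_ Omega)] `^ p)%E).
      exact: poweR_lty.
    rewrite poweR_Lnorm ?gt_eqF//; apply: eq_integral => x _.
    by rewrite gee0_abs ?lee_fin ?powR_ge0.
  apply: filterS u0 => x ux; rewrite (ger0_norm (powR_ge0 _ _)) lee_fin patchE.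
  by case: ifPn => // /negP; rewrite inE => /ux ->; rewrite normr0.
pose h z : R := `|(difference_quotient s p u \_ (Omega `*` setT)) z| `^ p.
have mh : measurable_fun setT h.
  apply: measurable_norm_powR; apply/(measurable_restrictT _ _).1 => //.
  exact: measurableX.
have mhE : measurable_fun setT (EFin \o h) by exact/measurable_EFinP.
have h0 z : 0 <= h z by exact: powR_ge0.
have hfin : (\int[mu2]_z (h z)%:E < +oo)%E.
  rewrite (_ : (\int[_]_x _)%E =
      ('N[mu2]_p%:E[EFin \o (difference_quotient s p u \_ (Omega `*` setT))] `^ p)%E).
    exact: poweR_lty.
  by rewrite poweR_Lnorm ?gt_eqF.
have ih : mu2.-integrable setT (EFin \o h).
  apply/integrableP; split; first exact/measurable_EFinP.
  by under eq_integral do rewrite /= ger0_norm//.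
(* The space controls the quotient only for a first point in [Omega]. Symmetry of the kernel covers
   a second point in [Omega], and when both points lie outside, [u] vanishes at almost all of
   them. *)
have ih' : mu2.-integrable setT (fun z => (h (z.2, z.1))%:E).
  apply/integrableP; split.
    apply/measurable_EFinP.
    exact: (measurableT_comp mh (@measurable_swap _ _ _ _)).
  under eq_integral do rewrite /= ger0_norm//.
  have E := @integral_swap _ _ R mu (EFin \o h) mhE (fun z => h0 z).
  by apply: le_lt_trans hfin; rewrite le_eqVlt; apply/orP; left; apply/eqP; exact: E.
have iE : mu2.-integrable setT (EFin \o energy_density p s u).
  apply: (ae_dominated_integrable _ (integrableD measurableT ih ih')).
    exact: measurable_energy_density.
  apply: filterS2 (ae_fst u0) (ae_snd u0) => -[x y] /= ux uy.
  rewrite (ger0_norm (energy_density_ge0 _ _ _ _)) -EFinD lee_fin.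
  have [Ox|Ox] := pselect (Omega x).
    apply: (@le_trans _ _ (h (x, y))); last by rewrite lerDl.
    by rewrite /h patchE mem_set// difference_quotientE.
  have [Oy|Oy] := pselect (Omega y).
    apply: (@le_trans _ _ (h (y, x))); last by rewrite lerDr.
    rewrite /h patchE mem_set// difference_quotientE.
    by rewrite /energy_density /= distrC kernC.
  by rewrite /energy_density /= ux// uy// subrr normr0 powR0 ?gt_eqF// mul0r addr_ge0.
exists psi; split => //.
- by move=> k; exact: tphi.
- exists (fun x => ((2 `^ p)%:E * ((`|u x| `^ p)%:E + g0 x))%E).
    apply: integrableZl => //; exact: (integrableD measurableT iu ig0).
  apply/nearW => x k.
  apply: (@le_trans _ _ (2 `^ p * (`|u x| `^ p + `|u x - psi k x| `^ p))%:E).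
    rewrite lee_fin; apply: le_trans (powRD_le (ltW p_gt0) (normr_ge0 _) (normr_ge0 _)).
    apply: ler_powR2 => //; first exact: ltW.
    by rewrite -[X in `|X| <= _](subKr (u x)) ler_normB.
  by rewrite EFinM lee_wpmul2l ?lee_fin ?powR_ge0// EFinD leeD2l.
- exists (fun z => ((2 `^ p)%:E * ((EFin \o energy_density p s u) z + g z))%E).
    apply: integrableZl => //; exact: (integrableD measurableT iE ig).
  apply/nearW => z k.
  apply: (@le_trans _ _ (2 `^ p * (energy_density p s u z +
      energy_density p s (u \- psi k) z))%:E).
    rewrite lee_fin /energy_density -mulrDl mulrA ler_wpM2r ?kern_ge0//.
    apply: le_trans (powRD_le (ltW p_gt0) (normr_ge0 _) (normr_ge0 _)).
    apply: ler_powR2 => //; first exact: ltW.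
    apply: le_trans (ler_normB _ _).
    by rewrite le_eqVlt; apply/orP; left; apply/eqP; congr `|_|; rewrite /=; ring.
  by rewrite EFinM lee_wpmul2l ?lee_fin ?powR_ge0// EFinD leeD2l.
Unshelve. all: by end_near. Qed.

End completion.

(** * Admissible compositions *)

Section soft_abs_limits.
Context (R : realType).
Implicit Types (u : nat -> R) (l r : R).

Lemma cvg_harmonicR : (k.+1%:R^-1 : R) @[k --> \oo] --> (0 : R).
Proof. exact: cvg_harmonic. Qed.

Lemma cvg_soft_abs u l : u k @[k --> \oo] --> l ->
  soft_abs k.+1%:R^-1 (u k) @[k --> \oo] --> `|l|.
Proof.
move=> ul; have h1 : `|u k| @[k --> \oo] --> `|l| by exact: cvg_norm.
have h2 : `|u k| + k.+1%:R^-1 @[k --> \oo] --> `|l|.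
  by rewrite -[X in _ --> X]addr0; apply: cvgD => //; exact: cvg_harmonicR.
apply: squeeze_cvgr h1 h2; near=> k.
by rewrite soft_abs_ge_norm soft_abs_le.
Unshelve. all: by end_near. Qed.

Lemma cvg_powR_gt0 u l r : 0 < l -> u k @[k --> \oo] --> l ->
  u k `^ r @[k --> \oo] --> l `^ r.
Proof.
move=> l0 ul; have cont : {for l, continuous (fun t => t `^ r)}.
  apply/differentiable_continuous/derivable1_diffP/derivable_powR.
  by rewrite in_itv/= andbT.
exact: (continuous_cvg _ cont ul).
Qed.

End soft_abs_limits.

Section compositions.
Context (R : realType) (n : nat) (p s q : R) (Omega : set 'rV[R]_n).
Hypotheses (n_gt0 : (0 < n)%N) (p_gt1 : 1 < p) (s_gt0 : 0 < s)
  (q_gt1 : 1 < q) (q_le_p : q <= p)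
  (Omega_open : open Omega) (Omega_bounded : bounded_set Omega).
Implicit Types (u v phi : 'rV[R]_n -> R) (psi : nat -> 'rV[R]_n -> R).

Local Notation mu := (rV_lebesgue R n).
Local Notation mu2 := (mu \x mu)%E.

Let p_gt0 : 0 < p. Proof. exact: lt_trans p_gt1. Qed.
Let q_gt0 : 0 < q. Proof. exact: lt_trans q_gt1. Qed.
Let mO : measurable Omega. Proof. exact: rV_open_measurable. Qed.

Lemma test_limit_ae_eq u v psi : measurable_fun setT v ->
  {ae mu, forall x, u x = v x} -> test_limit p s Omega u psi -> test_limit p s Omega v psi.
Proof.
move=> mv uv [tpsi mu' cpsi g0 g]; split => //.
by apply: filterS2 uv cpsi => x ->.
Qed.

Lemma test_limitN v psi : test_limit p s Omega v psi ->
  test_limit p s Omega (fun x => - v x) (fun k x => -1 * psi k x).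
Proof.
move=> [tpsi mv cpsi [g0 ig0 g0psi] [g ig gpsi]]; split.
- by move=> k; exact: test_functionZ.
- exact: measurableT_comp.
- apply: filterS cpsi => x vx; under eq_fun do rewrite mulN1r.
  exact: cvgN.
- exists g0 => //; apply: filterS g0psi => x h k.
  by rewrite mulN1r normrN.
- exists g => //; apply: filterS gpsi => z h k.
  by rewrite /energy_density -mulrBr mulN1r normrN; exact: h.
Qed.

Lemma energy_density_le (c : R) u v z : 0 <= c ->
  `|u z.1 - u z.2| <= c * `|v z.1 - v z.2| ->
  energy_density p s u z <= c `^ p * energy_density p s v z.
Proof.
move=> c0 uv; rewrite /energy_density mulrA ler_wpM2r ?kern_ge0//.
by rewrite -powRM// ler_powR2// ltW.
Qed.

(** Subtracting [e k], the value of [soft_abs] at 0, keeps the supports, and the Lipschitz constant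
    1 keeps the majorants of [psi]. *)
Lemma test_limit_norm v psi : test_limit p s Omega v psi ->
  exists psi', test_limit p s Omega (fun x => `|v x|) psi'.
Proof.
move=> [tpsi mv cpsi [g0 ig0 g0psi] [g ig gpsi]].
pose e k : R := k.+1%:R^-1; have e0 k : 0 < e k by rewrite invr_gt0.
exists (fun k x => soft_abs (e k) (psi k x) - e k); split.
- move=> k; have [Cpsi _ _] := tpsi k.
  apply: (test_function_smooth (tpsi k)) => [m|x ->].
    apply: of_class_CD; last exact: of_class_C_cst.
    exact: of_class_C_soft_abs.
  by rewrite soft_abs0 ?subrr// ltW.
- exact: measurableT_comp.
- apply: filterS cpsi => x vx; rewrite -[X in _ --> X]subr0.
  by apply: cvgB; [exact: cvg_soft_abs|exact: cvg_harmonicR].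
- exists g0 => //; apply: filterS g0psi => x h k; apply: le_trans (h k).
  rewrite lee_fin ler_powR2// ?(ltW p_gt0)// ger0_norm ?subr_ge0 ?soft_abs_ge ?(ltW (e0 k))//.
  by rewrite lerBlDr soft_abs_le// ltW.
- exists g => //; apply: filterS gpsi => z h k; apply: le_trans (h k).
  have := @energy_density_le 1 (fun x => soft_abs (e k) (psi k x) - e k) (psi k) z.
  rewrite powR1 !mul1r lee_fin; apply => //.
  by rewrite opprD addrACA subrr addr0 soft_abs_lip.
Qed.

Lemma norm_mul_diff_le (a b a' b' : R) (x x' y y' : R) :
  `|a - a'| <= x -> `|b| <= x' -> `|a'| <= y -> `|b - b'| <= y' ->
  `|a * b - a' * b'| <= x * x' + y * y'.
Proof.
move=> h1 h2 h3 h4.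
have -> : a * b - a' * b' = (a - a') * b + a' * (b - b') by ring.
by apply: le_trans (ler_normD _ _) _; rewrite !normrM lerD// ler_pM.
Qed.

(** The function |t|^q need not be smooth at 0, hence the detour through [soft_abs]. As [phi] is
    bounded, all bases lie in (0, M + 1], where the q-th power is Lipschitz uniformly in [k]. *)
Lemma test_function_powR_approx phi : test_function Omega phi ->
  exists (A : nat -> 'rV[R]_n -> R) (C1 C2 : R),
  [/\ [/\ forall k m, of_class_C m (A k), forall k x, phi x = 0 -> A k x = 0 &
      forall x, A k x @[k --> \oo] --> `|phi x| `^ q],
      0 <= C1, 0 <= C2,
      forall k x, `|A k x| <= C2 &
      forall k x y, `|A k x - A k y| <= C1 * `|phi x - phi y|].
Proof.
move=> tphi; have [Cphi _ _] := tphi; have [M phiM] := test_function_bounded tphi.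
have M0 : 0 <= M by apply: le_trans (phiM 0).
have e0 k : 0 < k.+1%:R^-1 :> R by rewrite invr_gt0.
have e0' k : 0 <= k.+1%:R^-1 :> R by rewrite ltW.
have softM k x : 0 < soft_abs k.+1%:R^-1 (phi x) <= M + 1.
  rewrite soft_abs_gt0//=; apply: le_trans (soft_abs_le _ (e0' k)) _.
  by apply: lerD => //; rewrite invf_le1// ler1n.
exists (fun k x => soft_abs k.+1%:R^-1 (phi x) `^ q - k.+1%:R^-1 `^ q).
exists (q * (M + 1) `^ (q - 1)), ((M + 1) `^ q); split => //.
- split=> [k m|k x ->|x].
  + apply: of_class_CD; last exact: of_class_C_cst.
    apply: of_class_C_powR; last exact: of_class_C_soft_abs.
    by move=> x; exact: soft_abs_gt0.
  + by rewrite soft_abs0// subrr.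
  + have h1 : soft_abs k.+1%:R^-1 (phi x) @[k --> \oo] --> `|phi x|.
      by apply: cvg_soft_abs; exact: cvg_cst.
    have := cvg_norm_powR (ltW q_gt1) h1.
    have := cvg_norm_powR (ltW q_gt1) (@cvg_harmonicR R).
    rewrite normr0 normr_id (powR0 (lt0r_neq0 q_gt0)) => h3 h2.
    rewrite -[X in _ --> X]subr0; apply: cvgB.
      by move: h2; under eq_fun do rewrite (ger0_norm (soft_abs_ge0 _ _)).
    by move: h3; under eq_fun => k do rewrite (ger0_norm (e0' k)).
- by rewrite mulr_ge0 ?powR_ge0 ?(ltW q_gt0).
- exact: powR_ge0.
- move=> k x; have /andP[s0 sM] := softM k x.
  rewrite ger0_norm; last by rewrite subr_ge0 ler_powR2 ?soft_abs_ge ?(ltW q_gt0).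
  rewrite lerBlDr (@le_trans _ _ ((M + 1) `^ q))//; last by rewrite lerDl powR_ge0.
  by rewrite ler_powR2 ?(ltW q_gt0)// ltW.
- move=> k x y; rewrite opprB addrA subrK.
  apply: le_trans (powR_lip_ge1 (ltW q_gt1) (softM k x) (softM k y)) _.
  by rewrite ler_wpM2l ?mulr_ge0 ?powR_ge0 ?(ltW q_gt0)// soft_abs_lip.
Qed.

(** The shift keeps the base away from 0, where a negative power is Lipschitz. The limit involves
    |l| because approximants of a nonnegative function may take negative values. *)
Lemma shifted_powR_approx psi (eps : R) : 0 < eps ->
  (forall k, test_function Omega (psi k)) ->
  exists (B : nat -> 'rV[R]_n -> R) (C1 C2 : R),
  [/\ [/\ forall k m, of_class_C m (B k) &
      forall x l, psi k x @[k --> \oo] --> l ->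
        B k x @[k --> \oo] --> (`|l| + eps) `^ (- (q - 1))],
      0 <= C1, 0 <= C2,
      forall k x, `|B k x| <= C2 &
      forall k x y, `|B k x - B k y| <= C1 * `|psi k x - psi k y|].
Proof.
move=> eps0 tpsi.
have e0 k : 0 < k.+1%:R^-1 :> R by rewrite invr_gt0.
have e0' k : 0 <= k.+1%:R^-1 :> R by rewrite ltW.
have D0 k x : eps <= soft_abs k.+1%:R^-1 (psi k x) + eps.
  by rewrite lerDr soft_abs_ge0.
have q1 : - (q - 1) <= 0 by rewrite oppr_le0 subr_ge0 ltW.
exists (fun k x => (soft_abs k.+1%:R^-1 (psi k x) + eps) `^ (- (q - 1))).
exists (`|- (q - 1)| * eps `^ (- (q - 1) - 1)), (eps `^ (- (q - 1))); split.
- split=> [k m|x l xl].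
  + have [Cpsi _ _] := tpsi k.
    apply: of_class_C_powR; first by move=> x; apply: lt_le_trans (D0 k x).
    apply: of_class_CD; last exact: of_class_C_cst.
    exact: of_class_C_soft_abs.
  + apply: cvg_powR_gt0; first by rewrite ltr_wpDl.
    by apply: cvgD; [exact: cvg_soft_abs|exact: cvg_cst].
- by rewrite mulr_ge0 ?powR_ge0.
- exact: powR_ge0.
- move=> k x; rewrite ger0_norm ?powR_ge0//.
  rewrite !(powRN _ (q - 1)) lef_pV2 ?posrE ?powR_gt0// ?(lt_le_trans eps0)//.
  by rewrite ler_powR2 ?subr_ge0 ?(ltW eps0)// ltW.
- move=> k x y; apply: le_trans (powR_lip_neg q1 eps0 (D0 k x) (D0 k y)) _.
  have E (a b : R) : a + eps - (b + eps) = a - b by ring.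
  rewrite E.
  by rewrite ler_wpM2l ?mulr_ge0 ?powR_ge0// soft_abs_lip.
Qed.

(** A product rule: the factors [A k] confine the supports to that of [phi], and since both factors
    are bounded and Lipschitz in [phi] and [psi k], the differences of the products are controlled
    by those of [phi] and [psi k]. *)
Lemma test_limit_picone u psi phi (eps : R) : test_limit p s Omega u psi ->
  test_function Omega phi -> mu2.-integrable setT (EFin \o energy_density p s phi) ->
  0 < eps -> exists psi',
  test_limit p s Omega (fun x => `|phi x| `^ q / (`|u x| + eps) `^ (q - 1)) psi'.
Proof.
move=> [tpsi mu' cpsi [g0 ig0 g0psi] [g ig gpsi]] tphi iphi eps0.
have mphi := measurable_test_function tphi.
have [A [a1 [a2 [[CA A0 cA] a10 a20 Ale Alip]]]] := test_function_powR_approx tphi.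
have [B [b1 [b2 [[CB cB] b10 b20 Ble Blip]]]] := shifted_powR_approx eps0 tpsi.
have c10 : 0 <= a1 * b2 by exact: mulr_ge0.
have c20 : 0 <= a2 * b1 by exact: mulr_ge0.
have ABlip k x y : `|A k x * B k x - A k y * B k y| <=
    a1 * b2 * `|phi x - phi y| + a2 * b1 * `|psi k x - psi k y|.
  rewrite [a1 * b2 * _]mulrAC -[a2 * b1 * _]mulrA.
  by apply: norm_mul_diff_le.
exists (fun k x => A k x * B k x); split.
- move=> k; apply: (test_function_smooth tphi) => [m|x /A0 ->].
    exact: of_class_CM.
  by rewrite mul0r.
- apply: measurable_funM; first exact: measurable_norm_powR.
  under eq_fun do rewrite -powRN.
  apply: (measurableT_comp (@measurable_powR R _)).
  by apply: measurable_funD => //; exact: measurableT_comp.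
- by apply: filterS cpsi => x ux; rewrite -powRN; apply: cvgM; [exact: cA|exact: cB].
- exists (fun x => ((a2 * b2) `^ p * \1_Omega x)%:E).
    under eq_fun do rewrite EFinM.
    apply: integrableZl => //; apply/integrableP; split.
      exact/measurable_EFinP.
    under eq_integral do rewrite /= ger0_norm//.
    by rewrite integral_indic// setIT; exact: bounded_measure_lty.
  apply/nearW => x k; rewrite lee_fin indicE.
  have [Ox|nOx] := pselect (Omega x).
    by rewrite mem_set// mulr1 ler_powR2 ?(ltW p_gt0)// normrM ler_pM.
  rewrite memNset// mulr0 A0; last exact: (test_function_eq0 tphi nOx).
  by rewrite mul0r normr0 powR0// gt_eqF.
- exists (fun z => ((2 `^ p)%:E * (((a1 * b2) `^ p)%:E * (EFin \o energy_density p s phi) z +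
      ((a2 * b1) `^ p)%:E * g z))%E).
    apply: integrableZl => //.
    have i1 := integrableZl measurableT ((a1 * b2) `^ p) iphi.
    have i2 := integrableZl measurableT ((a2 * b1) `^ p) ig.
    exact: (integrableD measurableT i1 i2).
  apply: filterS gpsi => z h k.
  apply: (@le_trans _ _ (2 `^ p * ((a1 * b2) `^ p * energy_density p s phi z +
      (a2 * b1) `^ p * energy_density p s (psi k) z))%:E).
    rewrite lee_fin /energy_density.
    rewrite [(a1 * b2) `^ p * _]mulrA [(a2 * b1) `^ p * _]mulrA -mulrDl mulrA.
    rewrite ler_wpM2r ?kern_ge0//.
    rewrite -[(a1 * b2) `^ p * _]powRM// -[(a2 * b1) `^ p * _]powRM//.
    apply: le_trans (powRD_le (ltW p_gt0) _ _); rewrite ?(mulr_ge0 c10) ?(mulr_ge0 c20)//.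
    by apply: ler_powR2 => //; exact: ltW.
  rewrite EFinM lee_wpmul2l ?lee_fin ?powR_ge0// EFinD; apply: leeD.
    by rewrite EFinM.
  by rewrite EFinM lee_wpmul2l ?lee_fin ?powR_ge0//; exact: h.
Qed.

End compositions.

(** * Sign of near-minimal solutions *)

Section excess.
Context (R : realType) (p : R).
Hypothesis p_gt1 : 1 < p.
Implicit Types (a b e w : R).

Let p_gt0 : 0 < p. Proof. exact: lt_trans p_gt1. Qed.
Let p1_ge0 : 0 <= p - 1. Proof. by rewrite subr_ge0 ltW. Qed.

(* What the energy loses when [u] is tested with [`|u|] instead of [u]. *)
Definition excess a b : R := `|a - b| `^ p - signed_pow p (a - b) * (`|a| - `|b|).

Lemma excess_ge0 a b : 0 <= excess a b.
Proof.
rewrite subr_ge0; apply: le_trans (ler_norm _) _.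
rewrite normrM norm_signed_pow// -[leRHS](@mulr_powRB1 _ _ p)// mulrC.
by rewrite ler_wpM2r ?powR_ge0// ler_dist_dist.
Qed.

Lemma excess_neg_nneg a b : a < 0 -> 0 <= b ->
  excess a b = 2 * `|a| * (`|a| + b) `^ (p - 1).
Proof.
move=> a0 b0; rewrite /excess (ltr0_norm a0) (ger0_norm b0).
have ab : 0 <= - a + b by rewrite addr_ge0// oppr_ge0 ltW.
have -> : a - b = - (- a + b) by ring.
rewrite normrN signed_powN (ger0_norm ab) ger0_signed_pow//.
by rewrite -[X in X - _](@mulr_powRB1 _ _ p)//; ring.
Qed.

Lemma excess_neg_neg a b : a < 0 -> b < 0 -> excess a b = 2 * `|a - b| `^ p.
Proof.
move=> a0 b0; rewrite /excess (ltr0_norm a0) (ltr0_norm b0).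
have -> : - a - - b = - (a - b) by ring.
by rewrite mulrN signed_powM// opprK mulr_natl mulr2n.
Qed.

(** Interaction with a point where [u] exceeds [e]. For small |a| this linear bound is the strong
    one, as it beats |a|^q. *)
Lemma excess_ge_linear a b e : 0 <= e -> a <= 0 -> e < b ->
  2 * `|a| * e `^ (p - 1) <= excess a b.
Proof.
move=> e0; rewrite le_eqVlt => /predU1P[-> _|a0 eb].
  by rewrite normr0 mulr0 mul0r excess_ge0.
have b0 : 0 <= b by rewrite ltW// (le_lt_trans e0).
rewrite excess_neg_nneg// ler_wpM2l ?mulr_ge0//.
by rewrite ler_powR2// (le_trans (ltW eb))// lerDr.
Qed.

(** If b < 0, then b >= -e > a/2 gives |a - b| >= |a|/2; if b >= 0, then |a - b| >= |a|. The bound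
    is meant for integration against the kernel over the complement of a small set. *)
Lemma excess_ge_powR a b e : 0 < e -> a < - (2 * e) -> - e <= b ->
  2 * (2^-1 `^ p * `|a| `^ p) <= excess a b.
Proof.
move=> e0 ae eb; have a0 : a < 0 by rewrite (lt_trans ae)// oppr_lt0 mulr_gt0.
rewrite -powRM// ?normr_ge0//.
have [b0|b0] := ltP b 0.
  rewrite excess_neg_neg// ler_wpM2l// ler_powR2 ?(ltW p_gt0) ?mulr_ge0//.
  by rewrite (ltr0_norm a0) ltr0_norm; lra.
rewrite excess_neg_nneg// -mulrA ler_wpM2l//.
apply: (@le_trans _ _ (`|a| `^ p)).
  rewrite ler_powR2 ?(ltW p_gt0) ?mulr_ge0// ler_piMl// invf_le1// ler1n//.
rewrite -(@mulr_powRB1 _ `|a| p)// ler_wpM2l// ler_powR2// lerDl//.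
Qed.

(** For opposite signs |a - b| = |a| + |b| exceeds ||a| - |b|| by twice the smaller modulus, so by
    more than [e]; superadditivity of the p-th power concludes. *)
Lemma energy_gap a b e : 0 < e -> a < - e -> e < b ->
  `| `|a| - `|b| | `^ p + e `^ p <= `|a - b| `^ p.
Proof.
move=> e0 ae eb; have a0 : a < 0 by lra.
have b0 : 0 < b by lra.
rewrite (ltr0_norm a0) (gtr0_norm b0) (ltr0_norm (_ : a - b < 0)); last by lra.
apply: (@le_trans _ _ ((`|- a - b| + e) `^ p)).
  by rewrite powRD_ge ?(ltW p_gt1)// ltW.
rewrite ler_powR2 ?(ltW p_gt0)//; first by rewrite addr_ge0// ltW.
by have [h|h] := leP 0 (- a - b); [rewrite ger0_norm//|rewrite ltr0_norm//]; lra.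
Qed.

End excess.

(** * Normalized solutions and their energy *)

Section solutions.
Context (R : realType) (n : nat) (p s q : R) (Omega : set 'rV[R]_n).
Hypotheses (n_gt0 : (0 < n)%N) (p_gt1 : 1 < p) (s_gt0 : 0 < s)
  (q_gt1 : 1 < q) (q_le_p : q <= p)
  (Omega_open : open Omega) (Omega_bounded : bounded_set Omega).
Implicit Types (u v phi : 'rV[R]_n -> R) (psi : nat -> 'rV[R]_n -> R).

Local Notation mu := (rV_lebesgue R n).
Local Notation mu2 := (mu \x mu)%E.

Let p_gt0 : 0 < p. Proof. exact: lt_trans p_gt1. Qed.
Let q_gt0 : 0 < q. Proof. exact: lt_trans q_gt1. Qed.
Let mO : measurable Omega. Proof. exact: rV_open_measurable. Qed.

(** Vanishing outside [Omega] is required at every point, so that a point where [u] is nonzero is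
    known to lie in [Omega], where [kern_lb] applies. *)
Definition normalized_solution (lambda : R) u : Prop :=
  [/\ measurable_fun setT u, forall x, ~ Omega x -> u x = 0,
      exists psi, test_limit p s Omega u psi,
      (\int[mu]_(x in Omega) (`|u x| `^ q)%:E = 1)%E &
      weak_solution s p Omega (fun x => lambda * (`|u x| `^ (q - 2) * u x)) u].

Lemma normalized_solution_ae_eq lambda u v : measurable_fun setT v ->
  (forall x, ~ Omega x -> v x = 0) -> {ae mu, forall x, u x = v x} ->
  measurable_fun setT u -> (exists psi, test_limit p s Omega u psi) ->
  (\int[mu]_(x in Omega) (`|u x| `^ q)%:E = 1)%E ->
  weak_solution s p Omega (fun x => lambda * (`|u x| `^ (q - 2) * u x)) u ->
  normalized_solution lambda v.
Proof.
move=> mv v0 uv mu' [psi tl] u1 wu.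
have mrhs (w phi : 'rV[R]_n -> R) : measurable_fun setT w -> measurable_fun setT phi ->
    measurable_fun Omega (fun x => (lambda * (`|w x| `^ (q - 2) * w x) * phi x)%:E).
  move=> mw mphi; apply/measurable_EFinP; apply: measurable_funTS.
  apply: measurable_funM => //; apply: measurable_funM => //.
  by apply: measurable_funM => //; exact: measurable_norm_powR.
split => //.
- by exists psi; exact: test_limit_ae_eq tl.
- rewrite -u1; apply: ae_eq_integral => //.
  + by apply/measurable_EFinP; apply: measurable_funTS; exact: measurable_norm_powR.
  + by apply/measurable_EFinP; apply: measurable_funTS; exact: measurable_norm_powR.
  + by apply: filterS uv => x -> _.
- move=> phi tphi; have mphi := measurable_test_function tphi.
  transitivity (\int[mu2]_z (pairing p s u phi z)%:E)%E.
    apply: ae_eq_integral => //.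
    + by apply/measurable_EFinP; exact: (measurable_pairing p s mv mphi).
    + by apply/measurable_EFinP; exact: (measurable_pairing p s mu' mphi).
    + by apply: filterS2 (ae_fst uv) (ae_snd uv) => z; rewrite /pairing /signed_pow => -> -> _.
  rewrite [LHS](wu phi tphi); apply: ae_eq_integral => //; try exact: mrhs.
  by apply: filterS uv => x -> _.
Qed.

Lemma V0_normalized_solution lambda u : V0_space s p Omega u ->
  Lp_norm Omega q u = 1%E ->
  weak_solution s p Omega (fun x => lambda * (`|u x| `^ (q - 2) * u x)) u ->
  exists v, normalized_solution lambda v.
Proof.
move=> V0u /(Lp_normE _ q_gt1) u1 wu.
(* Over an empty [Omega] the normalizing integral would be 0. *)
have O0 : Omega !=set0.
  apply/set0P/negP => /eqP O0; move: u1; rewrite O0 integral_set0 => /eqP.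
  by rewrite eqe eq_sym oner_eq0.
have [psi tl] := V0_space_test_limit p_gt1 Omega_open O0 V0u.
have [_ mu' _ _ _] := tl.
exists (u \_ Omega); apply: (normalized_solution_ae_eq _ _ _ mu') wu => //.
- by apply/(measurable_restrictT _ _).1 => //; exact: measurable_funTS.
- by move=> x nOx; rewrite patchE memNset.
- apply: filterS (test_limit_eq0 tl) => x ux; rewrite patchE.
  by case: ifPn => // /negP; rewrite inE => /ux.
- by exists psi.
Qed.

Lemma normalized_solutionN lambda u : normalized_solution lambda u ->
  normalized_solution lambda (fun x => - u x).
Proof.
move=> [mu' u0 [psi tl] u1 wu]; split.
- exact: measurableT_comp.
- by move=> x /u0 ->; rewrite oppr0.
- by eexists; exact: test_limitN tl.
- by under eq_integral do rewrite normrN.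
- move=> phi tphi; have mphi := measurable_test_function tphi.
  have := wu (fun x => -1 * phi x) (test_functionZ (-1) tphi).
  under eq_integral do rewrite -mulrBr mulN1r mulrN -mulNr.
  move=> E; apply: etrans (etrans _ E) _.
    by apply: eq_integral => z _; rewrite -opprD normrN mulrN.
  by apply: eq_integral => x _; rewrite normrN; congr (_%:E); ring.
Qed.

Section one_solution.
Context (lambda : R) (u : 'rV[R]_n -> R).
Hypothesis solu : normalized_solution lambda u.

Lemma solution_energy_integrable : mu2.-integrable setT (EFin \o energy_density p s u).
Proof. by have [_ _ [psi /test_limit_energy[]]] := solu. Qed.

Lemma solution_test v psi : test_limit p s Omega v psi ->
  [/\ mu2.-integrable setT (EFin \o pairing p s u v),
      mu.-integrable Omega (fun x => (lambda * signed_pow q (u x) * v x)%:E) &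
      (\int[mu2]_z (pairing p s u v z)%:E =
       \int[mu]_(x in Omega) (lambda * signed_pow q (u x) * v x)%:E)%E].
Proof.
have [mu' _ [psiu tlu] _ wu] := solu; apply: weak_solution_test_limit => //.
- exact: solution_energy_integrable.
- exact: test_limit_Lp tlu.
Qed.

Lemma solution_integrable_powR r : 0 <= r <= p ->
  mu.-integrable Omega (fun x => (`|u x| `^ r)%:E).
Proof.
move=> r0p; have [mu' _ [psi tl] _ _] := solu.
exact: (Lp_integrable_powR Omega_open Omega_bounded r0p mu' (test_limit_Lp p_gt1 tl)).
Qed.

Lemma solution_energy : (\int[mu2]_z (energy_density p s u z)%:E = lambda%:E)%E.
Proof.
have [mu' _ [psi tl] u1 _] := solu.
have [_ _ E] := solution_test tl.
transitivity (\int[mu2]_z (pairing p s u u z)%:E)%E.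
  by apply: eq_integral => z _; rewrite /pairing signed_powM.
rewrite E; under eq_integral do rewrite -mulrA signed_powM// EFinM.
rewrite integralZl//; first by rewrite u1 mule1.
by apply: solution_integrable_powR; rewrite (ltW q_gt0).
Qed.

Lemma solution_energy_section x :
  measurable_fun setT (fun y => (energy_density p s u (x, y))%:E).
Proof.
have [mu' _ _ _ _] := solu; apply/measurable_EFinP.
apply: (measurableT_comp (measurable_energy_density p s mu')).
exact: measurable_pair1.
Qed.

(** The energy of |u| is at least [L] and that of [u] is [lambda]. Every pair in the product of the
    two level sets contributes at least k e^p to the difference of the densities. *)
Lemma solution_superlevel_product (L k e : R) : (L%:E <= Lambda s p q Omega)%E ->
  0 <= k -> (forall x y, Omega x -> Omega y -> x != y -> k <= kern p s (x, y)) ->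
  0 < e ->
  ((k * e `^ p)%:E * (mu [set x : 'rV[R]_n | (u x < - e)%R] * mu [set x : 'rV[R]_n | (e < u x)%R]) <=
   (lambda - L)%:E)%E.
Proof.
move=> LL k0 kk e0; have [mu' u0 [psi tl] u1 _] := solu.
set N := [set x : 'rV[R]_n | u x < _]; set P := [set x : 'rV[R]_n | e < _].
have mN : measurable N by exact: measurable_sublevel.
have mP : measurable P by exact: measurable_superlevel.
have [psi' tl'] := test_limit_norm p_gt1 tl.
have [iabs _] := test_limit_energy p_gt1 tl'.
have [_ mabs _ _ _] := tl'.
have Labs : (L%:E <= \int[mu2]_z (energy_density p s (fun x => `|u x|%R) z)%:E)%E.
  rewrite -energyE; apply: (Lambda_le_test_limit _ _ _ _ _ LL tl') => //.
  by under eq_integral do rewrite normr_id.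
have : (\int[mu2]_z ((energy_density p s (fun x => `|u x|%R) z)%:E +
    (k * e `^ p)%:E * (\1_(N `*` P) z)%:E) <= lambda%:E)%E.
  rewrite -solution_energy; apply: ge0_le_integral => //.
  - move=> z _; apply: adde_ge0; first by rewrite lee_fin energy_density_ge0.
    by rewrite -EFinM lee_fin mulr_ge0// mulr_ge0// powR_ge0.
  - apply: emeasurable_funD.
      by apply/measurable_EFinP; exact: measurable_energy_density.
    apply: emeasurable_funM => //; apply/measurable_EFinP.
    by apply: measurable_indic; exact: measurableX.
  - by apply/measurable_EFinP; exact: measurable_energy_density.
  - move=> [x y] _; rewrite -EFinM -EFinD lee_fin indicE.
    have lip : energy_density p s (fun x => `|u x|) (x, y) <= energy_density p s u (x, y).
      rewrite /energy_density ler_wpM2r ?kern_ge0// ler_powR2 ?(ltW p_gt0)//.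
      exact: ler_dist_dist.
    have [[/= Nx Py]|nNP] := pselect ((N `*` P) (x, y)); last first.
      by rewrite memNset// mulr0 addr0.
    rewrite mem_set// mulr1 /energy_density /=.
    have Ox : Omega x by apply: contrapT => /u0 ux; move: Nx; rewrite /N/= ux; lra.
    have Oy : Omega y by apply: contrapT => /u0 uy; move: Py; rewrite /P/= uy; lra.
    have xy : x != y by apply: contraPneq Nx => -> /=; rewrite /N /P/= in Py *; lra.
    apply: (@le_trans _ _ ((`| `|u x| - `|u y| | `^ p + e `^ p) * kern p s (x, y))).
      by rewrite mulrDl lerD2l mulrC ler_wpM2l ?powR_ge0// kk.
    by rewrite ler_wpM2r ?kern_ge0// energy_gap.
rewrite ge0_integralD//; last 4 first.
- by move=> z _; rewrite lee_fin energy_density_ge0.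
- by apply/measurable_EFinP; exact: measurable_energy_density.
- by move=> z _; rewrite -EFinM lee_fin mulr_ge0// mulr_ge0// powR_ge0.
- apply: emeasurable_funM => //; apply/measurable_EFinP.
  by apply: measurable_indic; exact: measurableX.
rewrite ge0_integralZl_EFin//; last 2 first.
- by apply/measurable_EFinP; apply: measurable_indic; exact: measurableX.
- by rewrite mulr_ge0// powR_ge0.
rewrite integral_indic//; last exact: measurableX.
have NP : (mu2 (N `*` P) = mu N * mu P)%E by exact: product_measure1E.
rewrite setIT -[X in (_ -> _ * X <= _)%E]NP => H; rewrite EFinB leeBrDl//; apply: le_trans H.
by rewrite leeD2r.
Qed.

End one_solution.

End solutions.

(** * Lower bound for the set where a solution is not small *)

Section sign.
Context (R : realType) (n : nat) (p s q : R) (Omega : set 'rV[R]_n).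
Hypotheses (n_gt0 : (0 < n)%N) (p_gt1 : 1 < p) (s_gt0 : 0 < s)
  (q_gt1 : 1 < q) (q_le_p : q <= p)
  (Omega_open : open Omega) (Omega_bounded : bounded_set Omega).
Implicit Types (u v phi : 'rV[R]_n -> R) (psi : nat -> 'rV[R]_n -> R).

Local Notation mu := (rV_lebesgue R n).
Local Notation sol := (normalized_solution p s q Omega).

Let p_gt0 : 0 < p. Proof. exact: lt_trans p_gt1. Qed.
Let q_gt0 : 0 < q. Proof. exact: lt_trans q_gt1. Qed.
Let mO : measurable Omega. Proof. exact: rV_open_measurable. Qed.

Lemma section_integral_ge (c kappa : R) (A : set 'rV[R]_n) (f : 'rV[R]_n -> R) x :
  measurable A -> 0 <= c -> measurable_fun setT f -> (forall y, 0 <= f y) ->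
  (kappa%:E <= \int[mu]_(y in ~` A) (kern p s (x, y))%:E)%E ->
  (forall y, ~ A y -> c * kern p s (x, y) <= f y) ->
  ((c * kappa)%:E <= \int[mu]_y (f y)%:E)%E.
Proof.
move=> mA c0 mf f0 kA cf; have mCA := measurableC mA.
have mk : measurable_fun (~` A) (fun y => (kern p s (x, y))%:E).
  apply: measurable_funTS; apply/measurable_EFinP.
  exact: (measurableT_comp (measurable_kern p s) (measurable_pair1 x)).
apply: (@le_trans _ _ (\int[mu]_(y in ~` A) (c%:E * (kern p s (x, y))%:E))%E).
  rewrite ge0_integralZl_EFin//; last by move=> y _; rewrite lee_fin kern_ge0.
  by rewrite EFinM lee_wpmul2l.
apply: (@le_trans _ _ (\int[mu]_(y in ~` A) (f y)%:E)%E).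
  apply: ge0_le_integral => //.
  - by move=> y _; rewrite -EFinM lee_fin mulr_ge0// kern_ge0.
  - exact: measurable_funeM.
  - by apply: measurable_funTS; exact/measurable_EFinP.
apply: ge0_subset_integral => //; last by move=> y _; rewrite lee_fin.
exact/measurable_EFinP.
Qed.

(** Suppose |u| > e/2 only on a tiny set. A point with |u(x)| > e then sees |u(x) - u(y)| >=
    |u(x)|/2 outside that set, so the kernel makes its share of the energy a large multiple of
    |u(x)|^p. The bound on the energy leaves too little of the L^q norm. *)
Lemma solution_mass (lmax : R) : exists d m : R, [/\ 0 < d, 0 < m &
  forall lambda u, sol lambda u -> lambda <= lmax ->
    (m%:E <= mu [set x : 'rV[R]_n | (d < `|u x|)%R])%E].
Proof.
pose c := fine (mu Omega).
have cE : (mu Omega = c%:E)%E.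
  by rewrite fineK// ge0_fin_numE// bounded_measure_lty.
have c0 : 0 <= c by rewrite fine_ge0.
have c2 : 0 < 2 * (c + 1) by rewrite mulr_gt0// ltr_wpDl.
(* The points with |u| <= e carry at most half of the integral of |u|^q; the added 1 keeps the
   denominator positive. *)
pose e := (2 * (c + 1))^-1 `^ q^-1.
have e0 : 0 < e by rewrite powR_gt0// invr_gt0.
have eq : e `^ q = (2 * (c + 1))^-1.
  by rewrite -powRrM mulVf ?gt_eqF// powRr1// invr_ge0 ltW.
have eqc : e `^ q * c <= 2^-1.
  rewrite eq invfM -mulrA ler_piMr ?invr_ge0// mulrC ler_pdivrMr ?mul1r ?lerDl//.
  by rewrite ltr_wpDl.
(* For t > e, t^q <= K (t/2)^p. The factor 4 in [kappa] below makes K lambda / kappa at most 1/4,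
   and 1/2 + 1/4 < 1 is the contradiction. *)
pose K := e `^ (q - p) * 2 `^ p.
have K0 : 0 < K by rewrite mulr_gt0// powR_gt0.
pose lm := `|lmax| + 1; have lm0 : 0 < lm by rewrite ltr_wpDl.
pose kappa := 4 * K * lm.
have kappa0 : 0 < kappa by rewrite mulr_gt0// mulr_gt0.
have [m m0 Hm] := kern_integral_ge n_gt0 p_gt1 s_gt0 kappa.
exists (e / 2), m; split => //; first by rewrite divr_gt0.
move=> lambda u solu llm; have [mu' u0 _ u1 _] := solu.
set A := [set x | _]; rewrite leNgt; apply/negP => Am.
have mA : measurable A by apply: measurable_superlevel; exact: measurableT_comp.
have mE := solution_energy_section solu.
have mED := measurable_energy_density p s mu'.
have ED0 z := energy_density_ge0 p s u z.
have mF := measurable_integral_section mu mED ED0.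
have pointwise x : ((`|u x| `^ q)%:E <= (e `^ q)%:E +
    (K / kappa)%:E * \int[mu]_y (energy_density p s u (x, y))%:E)%E.
  have I0 : (0 <= (K / kappa)%:E * \int[mu]_y (energy_density p s u (x, y))%:E)%E.
    apply: mule_ge0; first by rewrite lee_fin divr_ge0 ?(ltW K0) ?(ltW kappa0).
    by apply: integral_ge0 => y _; rewrite lee_fin ED0.
  have [ue|eu] := leP `|u x| e.
    apply: (@le_trans _ _ (e `^ q)%:E); last by rewrite leeDl.
    by rewrite lee_fin ler_powR2// ltW.
  have e2e : e / 2 < e by rewrite ltr_pdivrMr// ltr_pMr// ltr1n.
  have Ax : A x by rewrite /A/= (lt_trans _ eu).
  apply: (@le_trans _ _ ((K / kappa)%:E * ((2^-1 * `|u x|) `^ p * kappa)%:E)%E); last first.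
    apply: (@le_trans _ _ ((K / kappa)%:E * \int[mu]_y (energy_density p s u (x, y))%:E)%E).
      rewrite lee_wpmul2l ?lee_fin ?divr_ge0 ?(ltW K0) ?(ltW kappa0)//.
      apply: (section_integral_ge mA) => //.
      - by apply/measurable_EFinP; exact: mE.
      - exact: Hm (ltW Am) Ax.
      move=> y /negP; rewrite -leNgt => uy.
      rewrite /energy_density ler_wpM2r ?kern_ge0// ler_powR2 ?(ltW p_gt0) ?mulr_ge0//=.
      by have := lerB_dist (u x) (u y); lra.
    by rewrite leeDr// lee_fin powR_ge0.
  rewrite -EFinM lee_fin; apply: le_trans (powR_above q_le_p e0 eu) _.
  rewrite powRM// powRV// /K le_eqVlt; apply/orP; left; apply/eqP.
  by field; rewrite !gt_eqF// powR_gt0.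
have : (1 <= (e `^ q * c)%:E + (K / kappa * lambda)%:E)%E.
  rewrite -u1; apply: (@le_trans _ _ (\int[mu]_(x in Omega) ((e `^ q)%:E +
      (K / kappa)%:E * \int[mu]_y (energy_density p s u (x, y))%:E))%E).
    apply: ge0_le_integral => //.
    - by apply/measurable_EFinP; apply: measurable_funTS; exact: measurable_norm_powR.
    - apply: measurable_funTS; apply: emeasurable_funD => //.
      exact: measurable_funeM.
  have F0 x : (0 <= \int[mu]_y (energy_density p s u (x, y))%:E)%E.
    by apply: integral_ge0 => y _; rewrite lee_fin ED0.
  have Kk0 : (0 <= (K / kappa)%:E)%E by rewrite lee_fin divr_ge0 ?(ltW K0) ?(ltW kappa0).
  rewrite ge0_integralD//; last 3 first.
  - by move=> x _; rewrite lee_fin powR_ge0.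
  - by move=> x _; rewrite mule_ge0.
  - by apply: measurable_funTS; exact: measurable_funeM.
  rewrite integral_cst// [X in (_ * X)%E]cE -EFinM leeD2l//.
  rewrite ge0_integralZl_EFin//; last exact: measurable_funTS.
  rewrite [X in (_ <= X)%E]EFinM lee_wpmul2l//.
  rewrite -(solution_energy p_gt1 q_gt1 q_le_p Omega_open Omega_bounded solu).
  exact: integral_sections_le.
rewrite -EFinD lee_fin leNgt => /negP; apply.
have : K / kappa * lambda <= 4^-1.
  have -> : K / kappa * lambda = 4^-1 * (lambda / lm).
    by rewrite /kappa; field; rewrite !gt_eqF.
  rewrite ler_piMr// ler_pdivrMr// mul1r (le_trans llm)//.
  by rewrite (le_trans (ler_norm _))// lerDl.
by lra.
Qed.

End sign.

(** * Nonnegativity of solutions close to the infimum *)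

Section nonnegativity.
Context (R : realType) (n : nat) (p s q : R) (Omega : set 'rV[R]_n).
Hypotheses (n_gt0 : (0 < n)%N) (p_gt1 : 1 < p) (s_gt0 : 0 < s)
  (q_gt1 : 1 < q) (q_le_p : q <= p)
  (Omega_open : open Omega) (Omega_bounded : bounded_set Omega).
Implicit Types (u v phi : 'rV[R]_n -> R) (psi : nat -> 'rV[R]_n -> R).

Local Notation mu := (rV_lebesgue R n).
Local Notation mu2 := (mu \x mu)%E.
Local Notation sol := (normalized_solution p s q Omega).

Let p_gt0 : 0 < p. Proof. exact: lt_trans p_gt1. Qed.
Let q_gt0 : 0 < q. Proof. exact: lt_trans q_gt1. Qed.
Let mO : measurable Omega. Proof. exact: rV_open_measurable. Qed.

Definition excess_density u (z : 'rV[R]_n * 'rV[R]_n) : R :=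
  excess p (u z.1) (u z.2) * kern p s z.

Definition neg_part u x : R := Num.max (- u x) 0.

Lemma excess_densityE u z :
  excess_density u z = energy_density p s u z - pairing p s u (fun x => `|u x|) z.
Proof. by rewrite /excess_density /excess mulrBl. Qed.

Lemma excess_density_ge0 u z : 0 <= excess_density u z.
Proof. by rewrite mulr_ge0 ?kern_ge0 ?excess_ge0. Qed.

Lemma measurable_excess_density u : measurable_fun setT u ->
  measurable_fun setT (excess_density u).
Proof.
move=> mu'; rewrite (funext (excess_densityE u)).
apply: measurable_funB; first exact: measurable_energy_density.
by apply: measurable_pairing => //; exact: measurableT_comp.
Qed.

Lemma measurable_neg_part u : measurable_fun setT u -> measurable_fun setT (neg_part u).
Proof. by move=> mu'; apply: measurable_maxr => //; exact: measurableT_comp. Qed.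

Lemma neg_part_ge0 u x : 0 <= neg_part u x.
Proof. by rewrite le_max lexx orbT. Qed.

(** The right-hand sides tested with [u] and with |u| differ only where [u] is negative. *)
Lemma neg_part_powR (lambda : R) u x :
  lambda * `|u x| `^ q - lambda * signed_pow q (u x) * `|u x| =
  2 * lambda * neg_part u x `^ q.
Proof.
rewrite /neg_part; have [ux|ux] := leP 0 (u x).
  rewrite max_r ?oppr_le0// powR0 ?gt_eqF// mulr0 -(signed_powM (u x) q_gt1).
  by rewrite ger0_norm// mulrA subrr.
rewrite max_l ?oppr_ge0 ?(ltW ux)// -(ltr0_norm ux) -(signed_powM (u x) q_gt1).
by rewrite ltr0_norm//; ring.
Qed.

(** Since u - |u| = -2 u^-, subtracting the equation tested with |u| from that tested with [u]
    amounts to testing with the negative part. *)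
Lemma solution_excess lambda u : sol lambda u ->
  (\int[mu2]_z (excess_density u z)%:E =
   \int[mu]_(x in Omega) (2 * lambda * neg_part u x `^ q)%:E)%E.
Proof.
move=> solu; have [mu' _ [psi tl] u1 _] := solu.
have [psi' tl'] := test_limit_norm p_gt1 tl.
have [iP iF E] := solution_test p_gt1 q_gt1 q_le_p Omega_open Omega_bounded solu tl'.
have iE := solution_energy_integrable p_gt1 solu.
have iu : mu.-integrable Omega (fun x => (`|u x| `^ q)%:E).
  apply: (solution_integrable_powR p_gt1 Omega_open Omega_bounded solu).
  by rewrite (ltW q_gt0).
have ilu : mu.-integrable Omega (fun x => (lambda * `|u x| `^ q)%:E).
  by under eq_fun do rewrite EFinM; exact: integrableZl.
transitivity (\int[mu2]_z ((energy_density p s u z)%:E - (pairing p s u (fun x => `|u x|%R) z)%:E))%E.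
  by apply: eq_integral => z _; rewrite -EFinB excess_densityE.
rewrite (integralB measurableT iE iP) /=.
rewrite [X in (X - _)%E](solution_energy p_gt1 q_gt1 q_le_p Omega_open Omega_bounded solu).
rewrite [X in (_ - X)%E]E.
have -> : (lambda%:E = \int[mu]_(x in Omega) (lambda * `|u x| `^ q)%:E)%E.
  under eq_integral do rewrite EFinM.
  by rewrite integralZl// u1 mule1.
rewrite -(integralB mO ilu iF); apply: eq_integral => x _.
by rewrite -EFinB neg_part_powR.
Qed.

(** With w = u^-, the sections of the excess satisfy c0 w + 4 lambda w^q <= 2 times the section
    integral. Integrated, the right side is at most 4 lambda times the integral of w^q by
    [solution_excess]; this cancels and leaves a nonpositive integral of c0 w. *)
Lemma solution_nonneg (L d m : R) : (L%:E <= Lambda s p q Omega)%E -> 0 < d -> 0 < m ->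
  exists2 eta, 0 < eta & forall lambda u, sol lambda u -> lambda <= L + 1 ->
    lambda - L <= eta -> (m%:E <= mu [set x : 'rV[R]_n | (d < u x)%R])%E ->
    {ae mu, forall x, 0 <= u x}.
Proof.
move=> LL d0 m0.
have [k k0 kk] := kern_lb n_gt0 p_gt1 s_gt0 Omega_bounded.
pose lm := `|L| + 1; have lm0 : 0 < lm by rewrite ltr_wpDl.
(* Half the coefficient that [excess_ge_linear] gives after integration over the set where u > d, of
   measure at least [m]. The level [e1] below solves 4 lm e1^(q-1) = c0, which uses q > 1. *)
pose c0 := d `^ (p - 1) * k * m.
have c00 : 0 < c0 by rewrite mulr_gt0// mulr_gt0// powR_gt0.
pose e1 := (c0 / (4 * lm)) `^ (q - 1)^-1.
have e10 : 0 < e1 by rewrite powR_gt0// divr_gt0// mulr_gt0.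
have q10 : 0 < q - 1 by rewrite subr_gt0.
pose e := Num.min d e1; have e0 : 0 < e by rewrite lt_min d0.
have ed : e <= d by rewrite ge_min lexx.
have ec : 4 * lm * e `^ (q - 1) <= c0.
  rewrite mulrC -ler_pdivlMr; last by rewrite mulr_gt0.
  have -> : c0 / (4 * lm) = e1 `^ (q - 1).
    by rewrite -powRrM mulVf ?gt_eqF// powRr1// ltW// divr_gt0// mulr_gt0.
  by rewrite ler_powR2 ?(ltW q10) ?(ltW e0)// ge_min lexx orbT.
pose K := e `^ (q - p) * 2 `^ p; have K0 : 0 < K by rewrite mulr_gt0// powR_gt0.
(* With this value the bound of [excess_ge_powR], integrated against the kernel, becomes 4 lm
   e^(q-p) |u(x)|^p, the second term of [splitting_powR] times 4 lm. *)
pose kappa := 2 * lm * K.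
have [m' m'0 Hm'] := kern_integral_ge n_gt0 p_gt1 s_gt0 kappa.
have e20 : 0 < e / 2 by rewrite divr_gt0.
have e2d : e / 2 <= d by rewrite ler_pdivrMr// (le_trans ed)// ler_peMr ?ler1n// ltW.
have ke0 : 0 < k * (e / 2) `^ p by rewrite mulr_gt0// powR_gt0.
(* Dividing the product bound by the measure [m] of the positive side leaves measure at most [m']
   for the set where u < -e/2. The level is e/2 because [excess_ge_powR] compares u(x) < -e with
   u(y) >= -e/2. *)
exists (k * (e / 2) `^ p * (m' * m)); first by rewrite mulr_gt0// mulr_gt0.
move=> lambda u solu lL leta Pm; have [mu' u0 _ u1 _] := solu.
have lam0 : 0 <= lambda.
  rewrite -lee_fin -(solution_energy p_gt1 q_gt1 q_le_p Omega_open Omega_bounded solu).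
  by apply: integral_ge0 => z _; rewrite lee_fin energy_density_ge0.
have llm : lambda <= lm by rewrite (le_trans lL)// lerD2r ler_norm.
have mF := measurable_excess_density mu'.
have F0 z := excess_density_ge0 u z.
have mFx x : measurable_fun setT (fun y => excess_density u (x, y)).
  exact: (measurableT_comp mF (measurable_pair1 x)).
set A := [set x : 'rV[R]_n | u x < - (e / 2)].
set P := [set x : 'rV[R]_n | d < u x] in Pm.
have mA : measurable A by exact: measurable_sublevel.
have mP : measurable P by exact: measurable_superlevel.
have Am' : (mu A <= m'%:E)%E.
  pose P' := [set x : 'rV[R]_n | e / 2 < u x].
  have H : ((k * (e / 2) `^ p)%:E * (mu A * mu P') <= (lambda - L)%:E)%E.
    by apply: (solution_superlevel_product _ _ _ _ _ solu LL _ kk) => //; exact: ltW.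
  have Pm' : (m%:E <= mu P')%E.
    apply: le_trans Pm _; apply: le_measure; rewrite ?inE//; first exact: measurable_superlevel.
    by move=> x; apply: le_lt_trans.
  have H2 : ((k * (e / 2) `^ p)%:E * (mu A * m%:E) <= (k * (e / 2) `^ p)%:E * (m' * m)%:E)%E.
    apply: (@le_trans _ _ (lambda - L)%:E).
      by apply: le_trans H; rewrite lee_wpmul2l ?lee_fin ?(ltW ke0)// lee_wpmul2l.
    by rewrite -EFinM lee_fin.
  have := H2; rewrite lee_pmul2l ?fin_numE// ?lte_fin//.
  by rewrite EFinM lee_pmul2r ?lte_fin.
have pointwise x : Omega x -> ((c0 * neg_part u x + 4 * lambda * neg_part u x `^ q)%:E <=
    2%:E * \int[mu]_y (excess_density u (x, y))%:E)%E.
  move=> Ox.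
  have I0 : (0 <= \int[mu]_y (excess_density u (x, y))%:E)%E.
    by apply: integral_ge0 => y _; rewrite lee_fin.
  have [ux|ux] := leP 0 (u x).
    rewrite /neg_part max_r ?oppr_le0// powR0 ?gt_eqF// !mulr0 addr0.
    by rewrite mule_ge0.
  have wE : neg_part u x = `|u x| by rewrite /neg_part max_l ?oppr_ge0 ?ltr0_norm// ltW.
  have w0 := neg_part_ge0 u x.
  have I1 : ((2 * c0 * neg_part u x)%:E <= \int[mu]_y (excess_density u (x, y))%:E)%E.
    apply: (@le_trans _ _ (\int[mu]_(y in P) (2 * neg_part u x * d `^ (p - 1) * k)%:E)%E).
      rewrite integral_cst//.
      have -> : 2 * c0 * neg_part u x = (2 * neg_part u x * d `^ (p - 1) * k) * m.
        by rewrite /c0; ring.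
      by rewrite EFinM lee_wpmul2l// lee_fin !mulr_ge0 ?powR_ge0// ltW.
    apply: (@le_trans _ _ (\int[mu]_(y in P) (excess_density u (x, y))%:E)%E).
      apply: ge0_le_integral => //.
      - by move=> y _; rewrite lee_fin !mulr_ge0 ?powR_ge0// ltW.
      - by apply: measurable_funTS; exact/measurable_EFinP.
      - move=> y Py; rewrite lee_fin /excess_density.
        have Oy : Omega y by apply: contrapT => /u0 uy; move: Py; rewrite /P/= uy; lra.
        have xy : x != y by apply: contraPneq ux => -> /=; rewrite /P/= in Py *; lra.
        apply: ler_pM; rewrite ?(ltW k0) ?mulr_ge0 ?powR_ge0//; last exact: kk.
        by rewrite wE excess_ge_linear// ltW.
    apply: ge0_subset_integral => //; last by move=> y _; rewrite lee_fin.
    by apply/measurable_EFinP; exact: mFx.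
  have I2 : ((if e < neg_part u x then 4 * lm * e `^ (q - p) * neg_part u x `^ p else 0)%:E <=
      \int[mu]_y (excess_density u (x, y))%:E)%E.
    case: ifPn => // ew.
    have Ax : A x by rewrite /A/=; move: ew; rewrite wE ltr0_norm//; lra.
    have -> : 4 * lm * e `^ (q - p) * neg_part u x `^ p =
        2 * (2^-1 `^ p * `|u x| `^ p) * kappa.
      rewrite wE powRV// /kappa /K; field.
      by rewrite gt_eqF// powR_gt0.
    apply: (section_integral_ge mA _ _ _ (Hm' A x mA Am' Ax)) => //.
    - move=> y /negP; rewrite -leNgt => uy.
      rewrite /excess_density ler_wpM2r ?kern_ge0//.
      apply: (excess_ge_powR p_gt1 e20) => //=.
      by move: ew; rewrite wE ltr0_norm//; lra.
  (* [I1] and [I2] bound the same section integral from below; adding them accounts for the factor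
     2. *)
  apply: (@le_trans _ _ ((2 * c0 * neg_part u x)%:E +
     (if e < neg_part u x then 4 * lm * e `^ (q - p) * neg_part u x `^ p else 0)%:E)%E); last first.
    by rewrite mule_natl mule2n leeD.
  rewrite -EFinD lee_fin.
  have := splitting_powR (ltW q_gt1) q_le_p e0 w0.
  set W := neg_part u x `^ q => HW.
  have H1 : 4 * lambda * W <= 4 * lm * W.
    by rewrite ler_wpM2r ?powR_ge0// ler_wpM2l.
  have H2 : 4 * lm * e `^ (q - 1) * neg_part u x <= c0 * neg_part u x.
    by rewrite ler_wpM2r.
  have lm40 : 0 <= 4 * lm by rewrite mulr_ge0// ltW.
  have {HW} := ler_wpM2l lm40 HW; clearbody c0 lm W; rewrite (mulrDr (4 * lm)) !mulrA.
  by case: ifP => _; rewrite ?mulr0; lra.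
have mw := measurable_neg_part mu'.
have mwq : measurable_fun setT (fun x => neg_part u x `^ q).
  exact: (measurableT_comp (@measurable_powR R q)).
have wq_fin : (\int[mu]_(x in Omega) (neg_part u x `^ q)%:E < +oo)%E.
  apply: (@le_lt_trans _ _ 1%E); last exact: ltry.
  rewrite -u1; apply: ge0_le_integral => //.
  - by move=> x _; rewrite lee_fin powR_ge0.
  - by apply: measurable_funTS; exact/measurable_EFinP.
  - by apply: measurable_funTS; apply/measurable_EFinP; exact: measurable_norm_powR.
  - move=> x _; rewrite lee_fin ler_powR2 ?(ltW q_gt0) ?neg_part_ge0//.
    by rewrite ge_max normr_ge0 andbT -normrN ler_norm.
have wq0 : (0 <= \int[mu]_(x in Omega) (neg_part u x `^ q)%:E)%E.
  by apply: integral_ge0 => x _; rewrite lee_fin powR_ge0.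
have key : (\int[mu]_(x in Omega) (c0 * neg_part u x + 4 * lambda * neg_part u x `^ q)%:E <=
    (4 * lambda)%:E * \int[mu]_(x in Omega) (neg_part u x `^ q)%:E)%E.
  apply: (@le_trans _ _ (\int[mu]_(x in Omega)
      (2%:E * \int[mu]_y (excess_density u (x, y))%:E))%E).
    apply: ge0_le_integral => //.
    - by move=> x _; rewrite lee_fin addr_ge0// !mulr_ge0 ?neg_part_ge0 ?powR_ge0// ltW.
    - apply: measurable_funTS; apply/measurable_EFinP.
      by apply: measurable_funD; apply: measurable_funM.
    - apply: measurable_funTS; apply: measurable_funeM.
      exact: measurable_integral_section.
  rewrite ge0_integralZl_EFin//; last 2 first.
  - by move=> x _; apply: integral_ge0 => y _; rewrite lee_fin.
  - by apply: measurable_funTS; exact: measurable_integral_section.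
  apply: (@le_trans _ _ (2%:E * \int[mu2]_z (excess_density u z)%:E)%E).
    by rewrite lee_wpmul2l// integral_sections_le.
  rewrite (solution_excess solu); under eq_integral do rewrite EFinM.
  rewrite ge0_integralZl_EFin//; last 3 first.
  - by move=> x _; rewrite lee_fin powR_ge0.
  - by apply: measurable_funTS; exact/measurable_EFinP.
  - by rewrite mulr_ge0.
  by rewrite muleA -EFinM (_ : 2 * (2 * lambda) = 4 * lambda)//; ring.
have : (\int[mu]_(x in Omega) (c0 * neg_part u x)%:E <= 0)%E.
  move: key; under eq_integral do rewrite EFinD.
  rewrite ge0_integralD//; last 4 first.
  - by move=> x _; rewrite lee_fin mulr_ge0 ?neg_part_ge0// ltW.
  - by apply: measurable_funTS; apply/measurable_EFinP; exact: measurable_funM.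
  - by move=> x _; rewrite lee_fin !mulr_ge0 ?powR_ge0.
  - by apply: measurable_funTS; apply/measurable_EFinP; exact: measurable_funM.
  under [X in (_ + X <= _)%E -> _]eq_integral do rewrite EFinM.
  rewrite ge0_integralZl_EFin//; last 3 first.
  - by move=> x _; rewrite lee_fin powR_ge0.
  - by apply: measurable_funTS; exact/measurable_EFinP.
  - by rewrite mulr_ge0.
  (* The cancellation is legitimate because the integral of w^q is finite, by [wq_fin]. *)
  rewrite -[X in (_ <= X)%E -> _]add0e leeD2rE//.
  by rewrite fin_numM// ge0_fin_numE.
move=> I0; have {}I0 : (\int[mu]_(x in Omega) `|(c0 * neg_part u x)%:E| = 0)%E.
  apply/eqP; rewrite eq_le integral_ge0// andbT.
  rewrite (eq_integral (fun x => (c0 * neg_part u x)%:E))// => x _.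
  by rewrite gee0_abs// lee_fin mulr_ge0 ?neg_part_ge0// ltW.
have mcw : measurable_fun Omega (fun x => (c0 * neg_part u x)%:E).
  by apply: measurable_funTS; apply/measurable_EFinP; exact: measurable_funM.
have := (ae_eq_integral_abs mu mO mcw).1 I0.
apply: filterS => x wx; have [Ox|nOx] := pselect (Omega x); last by rewrite u0.
have /eqP := wx Ox; rewrite eqe mulf_eq0 gt_eqF//= => /eqP w0.
by rewrite -oppr_le0 -w0 le_max lexx.
Qed.

End nonnegativity.

(** * Comparison by Picone's inequality *)

Section picone_comparison.
Context (R : realType) (n : nat) (p s q : R) (Omega : set 'rV[R]_n).
Hypotheses (n_gt0 : (0 < n)%N) (p_gt1 : 1 < p) (s_gt0 : 0 < s)
  (q_gt1 : 1 < q) (q_le_p : q <= p)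
  (Omega_open : open Omega) (Omega_bounded : bounded_set Omega).
Implicit Types (u v phi : 'rV[R]_n -> R) (psi : nat -> 'rV[R]_n -> R).

Local Notation mu := (rV_lebesgue R n).
Local Notation mu2 := (mu \x mu)%E.
Local Notation sol := (normalized_solution p s q Omega).

Let p_gt0 : 0 < p. Proof. exact: lt_trans p_gt1. Qed.
Let q_gt0 : 0 < q. Proof. exact: lt_trans q_gt1. Qed.
Let q1_gt0 : 0 < q - 1. Proof. by rewrite subr_gt0. Qed.
Let mO : measurable Omega. Proof. exact: rV_open_measurable. Qed.

Definition picone_test u phi (eps : R) x : R :=
  `|phi x| `^ q / (`|u x| + eps) `^ (q - 1).

(** Young's inequality turns the product in Picone's inequality into this combination, whose
    integral is [picone_total]. *)
Definition picone_bound u phi z : R :=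
  (1 - q / p) * energy_density p s u z + q / p * energy_density p s phi z.

Definition picone_deficit u phi (eps : R) z : R :=
  picone_bound u phi z - pairing p s u (picone_test u phi eps) z.

Lemma picone_bound_ge0 u phi z : 0 <= picone_bound u phi z.
Proof.
rewrite addr_ge0// mulr_ge0 ?energy_density_ge0//.
  by rewrite subr_ge0 ler_pdivrMr// mul1r.
by rewrite divr_ge0// ltW.
Qed.

(** Picone's inequality is applied to u + eps, which has the same differences as [u]. *)
Lemma picone_deficit_ge0 u phi (eps : R) z : (forall x, 0 <= u x) -> 0 < eps ->
  0 <= picone_deficit u phi eps z.
Proof.
move=> u0 e0; rewrite subr_ge0 /pairing /picone_bound /energy_density !mulrA -mulrDl.
rewrite ler_wpM2r ?kern_ge0// /picone_test !(ger0_norm (u0 _)).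
have a0 x : 0 < u x + eps by rewrite ltr_wpDl.
have := picone q_gt1 q_le_p (a0 z.1) (a0 z.2) (normr_ge0 (phi z.1)) (normr_ge0 (phi z.2)).
have -> : u z.1 + eps - (u z.2 + eps) = u z.1 - u z.2 by ring.
move=> /le_trans; apply.
apply: le_trans (powR_young q_gt0 q_le_p (normr_ge0 _) (normr_ge0 _)).
by rewrite ler_wpM2l ?powR_ge0// ler_powR2 ?(ltW q_gt0)// ler_dist_dist.
Qed.

Section comparison.
Context (lambda : R) (u phi : 'rV[R]_n -> R).
Hypotheses (solu : sol lambda u) (u_ge0 : forall x, 0 <= u x) (lambda_gt0 : 0 < lambda)
  (tphi : test_function Omega phi)
  (phi1 : (\int[mu]_(x in Omega) (`|phi x| `^ q)%:E = 1)%E)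
  (iphi : mu2.-integrable setT (EFin \o energy_density p s phi)).

Let mphi : measurable_fun setT phi. Proof. exact: measurable_test_function tphi. Qed.
Let mu' : measurable_fun setT u. Proof. by have [] := solu. Qed.

Definition picone_total : R := (1 - q / p) * lambda + q / p * fine (energy s p phi).

Lemma picone_total_ge0 : 0 <= picone_total.
Proof.
have E0 : 0 <= fine (energy s p phi).
  by rewrite fine_ge0// integral_ge0// => z _; rewrite lee_fin energy_density_ge0.
rewrite addr_ge0// mulr_ge0//; [| exact: ltW |].
  by rewrite subr_ge0 ler_pdivrMr// mul1r.
by rewrite divr_ge0// ltW.
Qed.

Lemma measurable_picone_test (eps : R) : measurable_fun setT (picone_test u phi eps).
Proof.
apply: measurable_funM; first exact: measurable_norm_powR.
under eq_fun do rewrite -powRN.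
apply: (measurableT_comp (@measurable_powR R _)).
by apply: measurable_funD => //; exact: measurableT_comp.
Qed.

Lemma picone_test_ge0 (eps : R) x : 0 <= picone_test u phi eps x.
Proof. by rewrite divr_ge0 ?powR_ge0. Qed.

(** Both terms on the left are nonnegative and the right side does not depend on [eps]; so each term
    is bounded uniformly in [eps]. *)
Lemma picone_identity (eps : R) : 0 < eps ->
  (\int[mu2]_z (picone_deficit u phi eps z)%:E +
   \int[mu]_(x in Omega) (lambda * signed_pow q (u x) * picone_test u phi eps x)%:E =
   picone_total%:E)%E.
Proof.
move=> e0; have [_ _ [psi tl] _ _] := solu.
have [psi' tl'] := test_limit_picone p_gt1 q_gt1 Omega_open Omega_bounded tl tphi iphi e0.
have [iP iF E] := solution_test p_gt1 q_gt1 q_le_p Omega_open Omega_bounded solu tl'.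
have iE := solution_energy_integrable p_gt1 solu.
have i1 := integrableZl measurableT (1 - q / p) iE.
have i2 := integrableZl measurableT (q / p) iphi.
have iB : mu2.-integrable setT (EFin \o picone_bound u phi).
  exact: eq_integrable (integrableD measurableT i1 i2).
have -> : (\int[mu2]_z (picone_deficit u phi eps z)%:E = picone_total%:E -
    \int[mu]_(x in Omega) (lambda * signed_pow q (u x) * picone_test u phi eps x)%:E)%E.
  transitivity (\int[mu2]_z ((picone_bound u phi z)%:E -
      (pairing p s u (picone_test u phi eps) z)%:E))%E.
    by apply: eq_integral => z _; rewrite -EFinB.
  rewrite (integralB measurableT iB iP); congr (_ - _)%E; last exact: E.
  transitivity (\int[mu2]_z ((1 - q / p)%:E * (energy_density p s u z)%:E +
      (q / p)%:E * (energy_density p s phi z)%:E))%E.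
    by apply: eq_integral => z _; rewrite -!EFinM -EFinD.
  rewrite (integralD measurableT i1 i2).
  rewrite (integralZl measurableT iE) (integralZl measurableT iphi).
  rewrite [X in (_ * X + _)%E](solution_energy p_gt1 q_gt1 q_le_p Omega_open Omega_bounded solu).
  rewrite [X in (_ + _ * X)%E](_ : _ = (fine (energy s p phi))%:E).
    by rewrite -!EFinM -EFinD.
  by rewrite fineK//; exact: integrable_fin_num.
by rewrite subeK//; exact: integrable_fin_num.
Qed.

Lemma picone_rhs_ge0 (eps : R) x :
  0 <= lambda * signed_pow q (u x) * picone_test u phi eps x.
Proof.
rewrite mulr_ge0 ?picone_test_ge0// mulr_ge0 ?(ltW lambda_gt0)//.
by rewrite ger0_signed_pow ?powR_ge0.
Qed.

Lemma picone_deficit_integral_le (eps : R) : 0 < eps ->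
  (\int[mu2]_z (picone_deficit u phi eps z)%:E <= picone_total%:E)%E.
Proof.
move=> e0; rewrite -(picone_identity e0) leeDl// integral_ge0// => x _.
by rewrite lee_fin picone_rhs_ge0.
Qed.

Lemma picone_rhs_le (eps : R) : 0 < eps ->
  (\int[mu]_(x in Omega) (lambda * signed_pow q (u x) * picone_test u phi eps x)%:E <=
   picone_total%:E)%E.
Proof.
move=> e0; rewrite -(picone_identity e0) leeDr// integral_ge0// => z _.
by rewrite lee_fin picone_deficit_ge0.
Qed.

(* The strong minimum principle: on a pair of a zero [x] of [u] and a point [y]
   where [u] is positive, the deficit blows up as [eps] tends to 0. *)
Lemma measure_zero_level (eta : R) : 0 < eta ->
  mu (Omega `&` ([set x | u x = 0] `&` [set x | eta <= `|phi x| `^ q])) = 0%E.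
Proof.
move=> eta0; set Z := (_ `&` (_ `&` _)).
have [d [m [d0 m0 Hm]]] := solution_mass n_gt0 p_gt1 s_gt0 q_gt1 q_le_p Omega_open Omega_bounded lambda.
have [k k0 kk] := kern_lb n_gt0 p_gt1 s_gt0 Omega_bounded.
have [M phiM] := test_function_bounded tphi.
have [_ u0 _ _ _] := solu.
have M0 : 0 <= M by apply: le_trans (phiM 0).
set P := [set x : 'rV[R]_n | d < u x].
have Pm : (m%:E <= mu P)%E.
  rewrite (_ : P = [set x | d < `|u x|]); first exact: Hm solu (lexx _).
  by apply/seteqP; split => x; rewrite /P/= ger0_norm.
have mP : measurable P by exact: measurable_superlevel.
have PO : P `<=` Omega.
  by move=> x; rewrite /P/= => dx; apply: contrapT => /u0 ux; move: dx; rewrite ux; lra.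
have mZ : measurable Z.
  apply: measurableI => //; apply: measurable_level_set => //.
  exact: measurable_norm_powR.
have Ofin : (mu Omega < +oo)%E by exact: bounded_measure_lty.
have Zfin : mu Z \is a fin_num.
  rewrite ge0_fin_numE//; apply: le_lt_trans Ofin; apply: le_measure; rewrite ?inE//.
  by move=> x [].
apply/eqP; rewrite eq_le measure_ge0 andbT leNgt; apply/negP => Z0.
pose z0 := fine (mu Z); have z00 : 0 < z0 by rewrite -lte_fin fineK.
(* [C] bounds the Picone test function where u > d, for every [eps]. [Y] is such that the deficit
   integrated over the product of [Z] and [P] would reach [picone_total] + 1, and [eps] lifts the
   test function to at least C + Y on [Z]. *)
pose C := M `^ q / d `^ (q - 1); have C0 : 0 <= C by rewrite divr_ge0 ?powR_ge0.
pose T := k * d `^ (p - 1) * (z0 * m).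
have T0 : 0 < T by rewrite !mulr_gt0// powR_gt0.
pose Y := (picone_total + 1) / T.
have Y0 : 0 < Y by rewrite divr_gt0// ltr_wpDl// picone_total_ge0.
have kY0 : 0 <= k * d `^ (p - 1) * Y.
  by rewrite mulr_ge0 ?(ltW Y0)// mulr_ge0 ?powR_ge0// ltW.
have CY : 0 < C + Y by rewrite ltr_wpDl.
pose eps := (eta / (C + Y)) `^ (q - 1)^-1.
have eps0 : 0 < eps by rewrite powR_gt0// divr_gt0.
have epsE : eta / eps `^ (q - 1) = C + Y.
  rewrite -powRrM mulVf ?gt_eqF// powRr1; last by rewrite ltW// divr_gt0.
  by rewrite invf_div mulrCA divff ?gt_eqF// mulr1.
have := picone_deficit_integral_le eps0; rewrite leNgt => /negP; apply.
apply: (@lt_le_trans _ _ ((k * d `^ (p - 1) * Y)%:E * (mu Z * mu P))%E).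
  apply: (@lt_le_trans _ _ ((k * d `^ (p - 1) * Y)%:E * (z0 * m)%:E)%E).
    rewrite -EFinM lte_fin (_ : k * d `^ (p - 1) * Y * (z0 * m) = picone_total + 1).
      by rewrite ltrDl.
    by rewrite /Y /T; field; rewrite !gt_eqF// powR_gt0.
  rewrite lee_wpmul2l ?lee_fin//.
  by rewrite EFinM [z0%:E]fineK// lee_wpmul2l.
have ZP : (mu2 (Z `*` P) = mu Z * mu P)%E by exact: product_measure1E.
have mZP : measurable (Z `*` P) by exact: measurableX.
rewrite -ZP -(integral_cst mu2 mZP).
have mD : measurable_fun setT (fun z => (picone_deficit u phi eps z)%:E).
  apply/measurable_EFinP; apply: measurable_funB.
    by apply: measurable_funD; apply: measurable_funM => //; exact: measurable_energy_density.
  by apply: measurable_pairing => //; exact: measurable_picone_test.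
apply: (@le_trans _ _ (\int[mu2]_(z in Z `*` P) (picone_deficit u phi eps z)%:E)%E); last first.
  by apply: ge0_subset_integral => // z _; rewrite lee_fin picone_deficit_ge0.
apply: ge0_le_integral => //.
- exact: measurable_funTS.
move=> [x y] [[/= Ox [ux phix]] Py]; rewrite lee_fin.
have Oy := PO _ Py.
have xy : x != y by apply: contraPneq ux => -> uy; move: Py; rewrite /P/= uy; lra.
apply: (@le_trans _ _ (- pairing p s u (picone_test u phi eps) (x, y))); last first.
  by rewrite lerDr picone_bound_ge0.
rewrite /pairing /= ux sub0r signed_powN !mulNr opprK.
have uy0 := u_ge0 y; rewrite ger0_signed_pow//.
have hx : C + Y <= picone_test u phi eps x.
  rewrite -epsE /picone_test ux normr0 add0r ler_wpM2r//.
  by rewrite invr_ge0 powR_ge0.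
have hy : picone_test u phi eps y <= C.
  rewrite /picone_test /C (ger0_norm uy0); apply: ler_pM; rewrite ?powR_ge0 ?invr_ge0 ?powR_ge0//.
    by rewrite ler_powR2 ?(ltW q_gt0).
  have dy : d <= u y + eps by rewrite -[d]addr0 lerD ?(ltW eps0) ?(ltW Py).
  rewrite lef_pV2 ?posrE ?powR_gt0 ?(lt_le_trans d0 dy)//.
  by rewrite ler_powR2 ?(ltW q1_gt0) ?(ltW d0).
have hxy : Y <= picone_test u phi eps x - picone_test u phi eps y by lra.
rewrite [leLHS](_ : _ = d `^ (p - 1) * Y * k); last by ring.
apply: ler_pM; [by rewrite mulr_ge0 ?powR_ge0 ?(ltW Y0)|exact: ltW| |exact: kk].
apply: ler_pM; rewrite ?powR_ge0 ?(ltW Y0)//.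
by rewrite ler_powR2 ?subr_ge0 ?(ltW p_gt1) ?(ltW d0) ?(ltW Py).
Qed.

(** Where u = 0 the tested right-hand side is 0 for every [eps], so convergence to lambda |phi|^q
    there requires phi = 0. *)
Lemma picone_vanish : {ae mu, forall x, Omega x -> u x = 0 -> phi x = 0}.
Proof.
pose Z k := Omega `&` ([set x : 'rV[R]_n | u x = 0] `&`
  [set x | (k.+1%:R^-1 : R) <= `|phi x| `^ q]).
have Z0 k : mu.-negligible (Z k).
  apply/negligibleP; last by apply: measure_zero_level; rewrite invr_gt0.
  apply: measurableI => //; apply: measurable_level_set => //.
  exact: measurable_norm_powR.
apply: (negligibleS _ (negligible_bigcup Z0)) => x /= nP.
have [phix|phix] := eqVneq (phi x) 0; first by exfalso; apply: nP.
have c0 : 0 < `|phi x| `^ q by rewrite powR_gt0// normr_gt0.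
have [k _ /(_ k (leqnn k))] := near_infty_natSinv_lt (PosNum c0).
move=> /= hk; exists k => //.
by split; [|split; last exact: ltW]; apply: contrapT => h; apply: nP.
Qed.

(** Letting [eps] tend to 0 in [picone_rhs_le], with majorant lambda |phi|^q, gives lambda <= (1 -
    q/p) lambda + (q/p) E for the energy E of [phi]; the terms in [lambda] combine. *)
Lemma solution_eigenvalue_le_finite : (lambda%:E <= energy s p phi)%E.
Proof.
have ip : mu.-integrable Omega (fun x => (lambda * `|phi x| `^ q)%:E).
  apply/integrableP; split.
    apply/measurable_EFinP; apply: measurable_funTS; apply: measurable_funM => //.
    exact: measurable_norm_powR.
  under eq_integral do rewrite gee0_abs ?lee_fin ?mulr_ge0 ?powR_ge0 ?(ltW lambda_gt0)// EFinM.
  rewrite ge0_integralZl_EFin ?(ltW lambda_gt0)//; last first.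
    by apply/measurable_EFinP; apply: measurable_funTS; exact: measurable_norm_powR.
  by rewrite phi1 mule1 ltry.
pose e k : R := k.+1%:R^-1; have e0 k : 0 < e k by rewrite invr_gt0.
have [] := @dominated_convergence _ _ _ mu Omega mO
  (fun k x => (lambda * signed_pow q (u x) * picone_test u phi (e k) x)%:E)
  (fun x => (lambda * `|phi x| `^ q)%:E) (fun x => (lambda * `|phi x| `^ q)%:E).
- move=> k; apply/measurable_EFinP; apply: measurable_funTS.
  apply: measurable_funM; last exact: measurable_picone_test.
  apply: measurable_funM => //.
  by apply: measurable_funM => //; exact: measurable_norm_powR.
- apply/measurable_EFinP; apply: measurable_funTS; apply: measurable_funM => //.
  exact: measurable_norm_powR.
- apply: filterS picone_vanish => x phi0 Ox; apply: cvg_EFin; first by near=> k.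
  have [ux|ux] := eqVneq (u x) 0.
    rewrite phi0// /picone_test phi0// normr0 powR0 ?gt_eqF// mulr0.
    under eq_fun do rewrite mul0r mulr0.
    exact: cvg_cst.
  have {}ux : 0 < u x by rewrite lt_neqAle eq_sym ux u_ge0.
  have U0 : 0 < u x `^ (q - 1) by rewrite powR_gt0.
  rewrite [X in X @ _](_ : _ = fun k =>
      lambda * (u x `^ (q - 1) * picone_test u phi (e k) x)); last first.
    by apply/funext => k /=; rewrite ger0_signed_pow// mulrA.
  apply: cvgMr; rewrite /picone_test (ger0_norm (u_ge0 x)).
  rewrite [X in _ --> X](_ : _ = u x `^ (q - 1) * (`|phi x| `^ q / u x `^ (q - 1))); last first.
    by field; rewrite gt_eqF.
  apply: cvgMr; apply: cvgMr; apply: cvgV; first by rewrite gt_eqF.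
  apply: cvg_powR_gt0 => //; rewrite -[X in _ --> X]addr0.
  by apply: cvgD; [exact: cvg_cst|exact: cvg_harmonicR].
- exact: ip.
- apply/nearW => x k Ox; rewrite gee0_abs ?lee_fin ?picone_rhs_ge0// -mulrA.
  rewrite ler_wpM2l ?(ltW lambda_gt0)// /picone_test ger0_signed_pow//.
  rewrite mulrCA ler_piMr ?powR_ge0// ler_pdivrMr ?mul1r ?(ger0_norm (u_ge0 x)); last first.
    by rewrite powR_gt0// ltr_wpDl.
  by rewrite ler_powR2 ?(ltW q1_gt0)// lerDl ltW.
move=> _ _ cv.
have : (\int[mu]_(x in Omega) (lambda * `|phi x| `^ q)%:E <= picone_total%:E)%E.
  by apply: cvge_le cv; near=> k; exact: picone_rhs_le.
under eq_integral do rewrite EFinM.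
rewrite ge0_integralZl_EFin ?(ltW lambda_gt0)//; last first.
  by apply/measurable_EFinP; apply: measurable_funTS; exact: measurable_norm_powR.
rewrite phi1 mule1 lee_fin /picone_total => H.
have fE : energy s p phi \is a fin_num by exact: integrable_fin_num.
rewrite -(fineK fE) lee_fin.
have qp0 : 0 < q / p by rewrite divr_gt0.
by rewrite -(ler_pM2l qp0); move: H; rewrite mulrBl mul1r; lra.
Unshelve. all: by end_near. Qed.

End comparison.

Lemma solution_eigenvalue_le lambda u phi : sol lambda u -> (forall x, 0 <= u x) ->
  0 < lambda -> test_function Omega phi ->
  (\int[mu]_(x in Omega) (`|phi x| `^ q)%:E = 1)%E ->
  (lambda%:E <= energy s p phi)%E.
Proof.
move=> solu u0 l0 tphi phi1.
have [Efin|] := ltP (energy s p phi) +oo%E; last first.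
  by rewrite leye_eq => /eqP ->; rewrite leey.
apply: (solution_eigenvalue_le_finite solu u0 l0 tphi phi1).
apply/integrableP; split.
  by apply/measurable_EFinP; apply: measurable_energy_density; exact: measurable_test_function tphi.
by under eq_integral do rewrite gee0_abs ?lee_fin ?energy_density_ge0//.
Qed.

End picone_comparison.

(** * Isolation of the infimum *)

Section isolation.
Context (R : realType) (n : nat) (p s q : R) (Omega : set 'rV[R]_n).
Hypotheses (n_gt0 : (0 < n)%N) (p_gt1 : 1 < p) (s_gt0 : 0 < s)
  (q_gt1 : 1 < q) (q_le_p : q <= p)
  (Omega_open : open Omega) (Omega_bounded : bounded_set Omega).

Local Notation mu := (rV_lebesgue R n).
Local Notation sol := (normalized_solution p s q Omega).

Lemma ae_nonneg_solution lambda u : sol lambda u -> {ae mu, forall x, 0 <= u x} ->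
  exists2 v, sol lambda v & forall x, 0 <= v x.
Proof.
move=> [mu' u0 tl u1 wu] uge0; exists (fun x => `|u x|) => //.
apply: (normalized_solution_ae_eq _ _ _ _ mu' tl u1 wu) => //.
- exact: measurableT_comp.
- by move=> x /u0 ->; rewrite normr0.
- by apply: filterS uge0 => x ux; rewrite ger0_norm.
Qed.

(** One of the sets where u > d and where -u > d has at least half the measure [m]; as the equation
    is odd, [u] may be replaced by its negative. *)
Lemma first_eigenvalue_isolated (L : R) : Lambda s p q Omega = L%:E ->
  exists2 eta, 0 < eta & forall lambda u, sol lambda u -> 0 < lambda ->
    lambda - L <= eta -> lambda <= L.
Proof.
move=> LE; have LL : (L%:E <= Lambda s p q Omega)%E by rewrite LE.
have [d [m [d0 m0 Hm]]] := solution_mass n_gt0 p_gt1 s_gt0 q_gt1 q_le_p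
  Omega_open Omega_bounded (L + 1).
have m20 : 0 < m / 2 by rewrite divr_gt0.
have [eta eta0 Heta] := solution_nonneg n_gt0 p_gt1 s_gt0 q_gt1 q_le_p
  Omega_open Omega_bounded LL d0 m20.
(* The cap 1 ensures lambda <= L + 1, the range for which [d], [m] and [eta] were obtained. *)
exists (Num.min eta 1); first by rewrite lt_min eta0 ltr01.
move=> lambda u solu l0; rewrite le_min => /andP[leta l1].
have lL : lambda <= L + 1 by rewrite -lerBlDl.
have [v solv v0] : exists2 v, sol lambda v & forall x, 0 <= v x.
  have [mu' _ _ _ _] := solu.
  have := Hm _ _ solu lL.
  have -> : [set x | d < `|u x|] = [set x | d < u x] `|` [set x | d < - u x].
    by apply/seteqP; split => x /=; rewrite ltr_normr => /orP.
  have mP : measurable [set x : 'rV[R]_n | d < u x] by exact: measurable_superlevel.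
  have mN : measurable [set x : 'rV[R]_n | d < - u x].
    by apply: measurable_superlevel; exact: measurableT_comp.
  move=> /le_trans/(_ (measureU2 _ mP mN)) mPN.
  have [Pm|Pm] := leP (m / 2)%:E (mu [set x : 'rV[R]_n | (d < u x)%R]).
    by apply: (ae_nonneg_solution solu); exact: Heta solu lL leta Pm.
  have solNu := normalized_solutionN solu.
  apply: (ae_nonneg_solution solNu); apply: (Heta _ _ solNu lL leta).
  rewrite leNgt; apply/negP => Nm.
  have := le_lt_trans mPN (lteD Pm Nm).
  by rewrite -EFinD -splitr ltxx.
rewrite -lee_fin -LE; apply: le_ereal_inf_tmp => _ [phi [tphi /(Lp_normE _ q_gt1) phi1] <-].
exact: (solution_eigenvalue_le n_gt0 p_gt1 s_gt0 q_gt1 q_le_p Omega_open Omega_bounded solv).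
Qed.

End isolation.

Theorem theorem1p5 (R : realType) (n : nat) (p s q : R) (Omega : set 'rV[R]_n)
    (n_gt0 : (0 < n)%N) (p_gt1 : 1 < p) (s_gt0 : 0 < s) (s_lt1 : s < 1)
    (q_gt1 : 1 < q) (q_le_p : q <= p)
    (Omega_open : open Omega) (Omega_bounded : bounded_set Omega)
    (Omega_regular : regular_boundary s p Omega) :
  ~ exists (lambda : nat -> R) (u : nat -> 'rV[R]_n -> R),
      [/\ forall i, (Lambda s p q Omega < (lambda i)%:E)%E,
          forall i, V0_space s p Omega (u i),
          forall i, Lp_norm Omega q (u i) = 1%E,
          (lambda i)%:E @[i --> \oo] --> Lambda s p q Omega &
          forall i, weak_solution s p Omega
            (fun x => lambda i * (`|u i x| `^ (q - 2) * u i x)) (u i)].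
Proof.
move=> [lambda [u [Llambda Vu u1 cvl wu]]].
have Lambda_ge0 : (0 <= Lambda s p q Omega)%E.
  apply: le_ereal_inf_tmp => _ [phi _ <-].
  by apply: integral_ge0 => z _; rewrite lee_fin energy_density_ge0.
(* The infimum is an extended real; it is finite because it is nonnegative and lies below
   [lambda 0]. *)
have LE : Lambda s p q Omega = (fine (Lambda s p q Omega))%:E.
  by rewrite fineK// ge0_fin_numE// (lt_trans (Llambda 0%N))// ltry.
set L := fine _ in LE; rewrite LE in cvl Llambda Lambda_ge0.
have [eta eta0 Heta] := first_eigenvalue_isolated n_gt0 p_gt1 s_gt0 q_gt1 q_le_p
  Omega_open Omega_bounded LE.
have : \forall i \near \oo, lambda i - L <= eta.
  have /fine_cvgP[_ cvl'] := cvl.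
  near=> i; rewrite lerBlDr ltW//; near: i.
  by apply: (cvgr_lt _ cvl'); rewrite ltrDr.
move=> [i _ /(_ i (leqnn i))] leta.
have [v solv] := V0_normalized_solution p_gt1 q_gt1 Omega_open (Vu i) (u1 i) (wu i).
have := Llambda i; rewrite lte_fin ltNge => /negP; apply.
(* Positivity of [lambda i] comes from 0 <= L < lambda i. *)
apply: Heta solv _ leta; apply: le_lt_trans (_ : L < _); last by rewrite -lte_fin.
by rewrite -lee_fin.
Unshelve. all: by end_near. Qed.
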